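(* Let $\mu_0\in\mathcal{N}_n$, let $(\cdot,\cdot)$ be an inner product on $\mathbb{R}^n$, and let $g(t)$ be the Ricci flow starting at $g=g_{\mu_0,(\cdot,\cdot)}$. Let $\{h(t)\}\subset\mathrm{GL}_n(\mathbb{R})\subset\mathrm{Diff}(\mathbb{R}^n)$ be the solution to the ODE $$\frac{d}{dt}h(t)=-h(t)\operatorname{Ric}_t,\qquad h(0)=I,$$ where $\operatorname{Ric}_t=\operatorname{Ric}(g(t))(0)$ is the Ricci operator of $g(t)$ at the point $0\in\mathbb{R}^n$. Then, as $t\to\infty$, the metrics $(h(t)^{-1})^*g(t)$ converge in $C^\infty$ to the flat metric $g_{0,(\cdot,\cdot)}$ uniformly on compact sets in $\mathbb{R}^n$.
   Context: $\mathcal{N}_n$ is the set of skew-symmetric bilinear maps $\mu:\mathbb{R}^n\times\mathbb{R}^n\to\mathbb{R}^n$ that satisfy the Jacobi identity and are nilpotent. For $\mu\in\mathcal{N}_n$, $(\mathbb{R}^n,\cdot_\mu)$ is the simply connected nilpotent Lie group with Lie algebra $(\mathbb{R}^n,\mu)$, identified with $\mathbb{R}^n$ via its exponential map (so $\cdot_\mu$ is given by the Baker-Campbell-Hausdorff formula). For an inner product $(\cdot,\cdot)$ on $\mathbb{R}^n$, $g_{\mu,(\cdot,\cdot)}$ is the left-invariant Riemannian metric on $(\mathbb{R}^n,\cdot_\mu)$ whose value at $0$ is $(\cdot,\cdot)$; these are the metrics on $\mathbb{R}^n$ regarded as invariant under a transitive nilpotent Lie group. For $\mu=0$ the product is vector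 addition, and $g_{0,(\cdot,\cdot)}$ is the flat, translation-invariant metric equal to $(\cdot,\cdot)$ at every point. The Ricci flow starting at $g$ is $\frac{\partial}{\partial t}g(t)=-2\operatorname{Rc}(g(t))$, $g(0)=g$, with $g(t)$ being $(\mathbb{R}^n,\cdot_{\mu_0})$-invariant for all $t$; it is defined for $t\in[0,\infty)$. Convergence of metrics on $\mathbb{R}^n$ in $C^\infty$ uniformly on compact sets: $g_t\to g$ means that, in the global coordinates of $\mathbb{R}^n$, for every multi-index $\alpha$ (including $\alpha=0$) the partial derivatives $\partial^\alpha(g_t)_{ij}$ converge to $\partial^\alpha g_{ij}$ uniformly on compact sets, for all $i,j$. *)

(* Defs.v *)
From HB Require Import structures.
From mathcomp Require Import all_boot all_order all_algebra.
From mathcomp Require Import all_classical all_reals all_analysis.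
Import Order.TTheory GRing.Theory Num.Theory.
Import numFieldNormedType.Exports.

Set Implicit Arguments.
Unset Strict Implicit.
Unset Printing Implicit Defensive.

Local Open Scope classical_set_scope.
Local Open Scope ring_scope.

(* R^n is the space 'cV[R]_n of column vectors, on which 'M[R]_n acts by left *)
(* multiplication.                                                            *)

Section NilpotentLieBrackets.
Variables (R : realType) (n : nat).
Implicit Type mu : 'cV[R]_n -> 'cV[R]_n -> 'cV[R]_n.

(* g^0 = g and g^(k+1) = [g, g^k]; for bilinear mu, brackets of basis vectors *)
(* span [g, g^k].                                                             *)
Fixpoint lower_central mu (k : nat) : {vspace 'cV[R]_n} :=
  if k is k'.+1 then
    <<[seq mu u v | u <- vbasis fullv, v <- vbasis (lower_central mu k')]>>%VS
  else fullv.

Record nilpotent_lie_bracket mu : Prop := {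
  bracket_linear_left : forall y, linear (mu ^~ y) ;
  bracket_linear_right : forall x, linear (mu x) ;
  bracket_skew : forall x y, mu x y = - mu y x ;
  bracket_jacobi : forall x y z,
    mu x (mu y z) + mu y (mu z x) + mu z (mu x y) = 0 ;
  bracket_nilpotent : exists k, lower_central mu k = 0%VS }.

(* [:: z1; ...; zd] |-> [z1, [z2, ... [z(d-1), zd]]] *)
Fixpoint iter_bracket mu (s : seq 'cV[R]_n) : 'cV[R]_n :=
  match s with
  | [::] => 0
  | [:: z] => z
  | z :: s' => mu z (iter_bracket mu s')
  end.

(* Baker-Campbell-Hausdorff product log (exp x exp y), in Dynkin's form: the  *)
(* sum over m >= 1 and over pairs (r_k, s_k) <> (0, 0), k < m, of             *)
(*   (-1)^(m-1) / (m * d * prod_k r_k! s_k!) [x^r_0 y^s_0 ... ]               *)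
(* where d = sum_k (r_k + s_k) is the length of the iterated bracket. The     *)
(* lower central series of a nilpotent bracket on R^n decreases strictly to   *)
(* 0, so the brackets of length d > n vanish and the sum stops at d = n.      *)
Definition bch mu (x y : 'cV[R]_n) : 'cV[R]_n :=
  \sum_(1 <= d < n.+1) \sum_(1 <= m < d.+1)
    \sum_(rs : {ffun 'I_m -> 'I_d.+1 * 'I_d.+1} |
            [forall k, 0 < (rs k).1 + (rs k).2]%N &&
            (\sum_k ((rs k).1 + (rs k).2) == d)%N)
      ((-1) ^+ m.-1 /
         (m * d * \prod_k ((rs k).1`! * (rs k).2`!))%N%:R) *:
      iter_bracket mu
        (flatten [seq nseq (rs k).1 x ++ nseq (rs k).2 y | k <- enum 'I_m]).

End NilpotentLieBrackets.

Section Metrics.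
Variables (R : realType) (n : nat).

(* The symmetric bilinear form (v, w) |-> v^T G w. *)
Definition inner_product (G : 'M[R]_n) : Prop :=
  G^T = G /\ forall v : 'cV[R]_n, v != 0 -> 0 < (v^T *m G *m v) 0 0.

Definition partial (i : 'I_n) (f : 'cV[R]_n -> R) : 'cV[R]_n -> R :=
  'D_(delta_mx i 0) f.

(* Multi-indices are encoded as the list of the successive directions of      *)
(* differentiation.                                                           *)
Definition partials (alpha : seq 'I_n) (f : 'cV[R]_n -> R) : 'cV[R]_n -> R :=
  foldr partial f alpha.

Definition smooth (f : 'cV[R]_n -> R) : Prop :=
  forall alpha x, differentiable (partials alpha f) x.

(* A field of bilinear forms on R^n, by its coefficients g_ij in the global   *)
(* coordinates.                                                               *)
Definition tensor := 'cV[R]_n -> 'M[R]_n.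

Implicit Type g : tensor.

Definition riemannian_metric g : Prop :=
  (forall i j, smooth (fun x => g x i j)) /\ (forall x, inner_product (g x)).

(* (f^* g)_x (v, w) = g_(f x) (df_x v, df_x w) *)
Definition pullback (f : 'cV[R]_n -> 'cV[R]_n) g : tensor := fun x =>
  \matrix_(i, j) (('D_(delta_mx i 0) f x)^T *m g (f x) *m
                    'D_(delta_mx j 0) f x) 0 0.

(* Gamma^k_ij = 1/2 g^kl (d_i g_jl + d_j g_il - d_l g_ij) *)
Definition christoffel g (k i j : 'I_n) : 'cV[R]_n -> R := fun x =>
  2^-1 * \sum_l invmx (g x) k l *
    (partial i (fun y => g y j l) x + partial j (fun y => g y i l) x
     - partial l (fun y => g y i j) x).

(* R(d_i, d_j) d_k = R_ijk^l d_l, where                                       *)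
(* R(X, Y) Z = nabla_X nabla_Y Z - nabla_Y nabla_X Z - nabla_[X, Y] Z         *)
Definition riemann g (i j k l : 'I_n) : 'cV[R]_n -> R := fun x =>
  partial i (christoffel g l j k) x - partial j (christoffel g l i k) x
  + \sum_p (christoffel g p j k x * christoffel g l i p x
            - christoffel g p i k x * christoffel g l j p x).

(* Rc(Y, Z) = tr (X |-> R(X, Y) Z) *)
Definition ricci_tensor g : tensor := fun x =>
  \matrix_(j, k) \sum_i riemann g i j k i x.

(* Rc(v, w) = g(Ric v, w) *)
Definition ricci_operator g (x : 'cV[R]_n) : 'M[R]_n :=
  invmx (g x) *m ricci_tensor g x.

Definition left_invariant (mu : 'cV[R]_n -> 'cV[R]_n -> 'cV[R]_n) g : Prop :=
  forall a x, pullback (bch mu a) g x = g x.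

(* The metric whose value at x is the pullback of G at 0 by left translation  *)
(* by the inverse of x, which is - x in exponential coordinates.              *)
Definition invariant_metric (mu : 'cV[R]_n -> 'cV[R]_n -> 'cV[R]_n)
    (G : 'M[R]_n) : tensor :=
  fun x => pullback (bch mu (- x)) (fun=> G) x.

(* Derivative of a curve defined on [0, +oo[ (one-sided at 0). *)
Definition is_derivative_on_nonneg (V : normedModType R) (c : R -> V) (t : R)
    (c' : V) : Prop :=
  (s - t)^-1 *: (c s - c t) @[s --> within [set s | 0 <= s] t^'] --> c'.

Record invariant_ricci_flow (mu : 'cV[R]_n -> 'cV[R]_n -> 'cV[R]_n)
    (g0 : tensor) (g : R -> tensor) : Prop := {
  flow_metric : forall t, 0 <= t -> riemannian_metric (g t) ;
  flow_eq : forall t x, 0 <= t ->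
    is_derivative_on_nonneg (fun s => g s x) t (- 2 *: ricci_tensor (g t) x) ;
  flow_init : forall x, g 0 x = g0 x ;
  flow_invariant : forall t, 0 <= t -> left_invariant mu (g t) }.

(* C^oo convergence, uniform on compact sets, as t -> +oo. *)
Definition cvg_smooth_compact (g : R -> tensor) (g' : tensor) : Prop :=
  forall (alpha : seq 'I_n) (i j : 'I_n),
    {family compact, (fun t => partials alpha (fun x => g t x i j)) @ +oo
                     --> partials alpha (fun x => g' x i j)}.

End Metrics.

(* Main.v *)
Require Import Defs.
From HB Require Import structures.
From mathcomp Require Import all_boot all_order all_algebra.
From mathcomp Require Import all_classical all_reals all_analysis.
From mathcomp Require Import zify ring lra.
Import Order.TTheory GRing.Theory Num.Theory.
Import numFieldNormedType.Exports.

Set Implicit Arguments.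
Unset Strict Implicit.
Unset Printing Implicit Defensive.

Local Open Scope classical_set_scope.
Local Open Scope ring_scope.

(* In exponential coordinates the derivative at x of the left translation by  *)
(* - x is the polynomial A_mu(x) = (1 - exp (- ad_x)) / ad_x, so that         *)
(* g(t) = A^T G_t A with G_t = g(t)(0). The equations for g and h give        *)
(* G_t = h(t)^T G h(t), hence (h(t)^-1)^* g(t) is the invariant metric of     *)
(* value G at 0 for the conjugate bracket mu(t) = h mu0(h^-1 ., h^-1 .). Its  *)
(* coefficients are polynomials in x and in the structure constants of mu(t), *)
(* so it suffices that mu(t) tend to 0. In an orthonormal frame the Ricci     *)
(* operator of a nilmanifold is the moment map                                *)
(*   Ric_de = - 1/2 sum c_dab c_eab + 1/4 sum c_abd c_abe,                    *)
(* which yields (|mu|^2)' = - 8 tr Ric^2 <= - |mu|^4 / (2 n), because         *)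
(* tr Ric = - |mu|^2 / 4.                                                     *)

(** Two mechanisms are combined. The first is a gauge argument. By [pullback_bch] and
    [left_invariantE], a left-invariant metric is determined by its value at $0$ through the matrix
    [translation_mx mu x]. Since $g' = -2\operatorname{Rc}$ and $h' = -h\operatorname{Ric}$, the
    form $h^{-T} g(t)(0)\, h^{-1}$ does not change with time ([flow_metric_at0]). Pulling back by
    $h(t)^{-1}$ therefore freezes the inner product and puts all time dependence into the bracket
    ([translation_mx_conj]). As the metric is polynomial in $x$ and in the structure constants
    ([cvg_poly_family_metric]), convergence of these constants to $0$ yields uniform convergence of
    every derivative on compact sets ([cvg_smooth_compact_family]).

    The second mechanism is the decay of the bracket. Curvature is defined in coordinates, so the
    Ricci tensor at $0$ is computed from the 2-jet of the metric ([mxjet2_metric]), which involves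
    only the first three coefficients of the Baker-Campbell-Hausdorff derivative. The vanishing of
    $\operatorname{tr}\operatorname{ad}_x$ and of the Killing form reduces the result to the
    classical formula ([ricci_invariant], [ricci_frame]). In a frame that stays orthonormal along
    the flow, the squared norm $N$ of the structure constants satisfies $N' =
    -8|\operatorname{Ric}|^2$ ([coef_norm2_derivative]), while $N^2 \le 16 n |\operatorname{Ric}|^2$
    ([coef_norm2_le]). Hence $N' \le -N^2/(2n)$, and [riccati_decay] gives $N \to 0$
    ([frame_coef_cvg0]). *)

Section NilpotentBracket.

(** * Nilpotency and traces of adjoint maps *)

Lemma mulmx_pow_swap (F : fieldType) (n r m : nat) (L : 'M[F]_(n, r))
    (T : 'M[F]_(r, n)) : (L *m T) ^+ m.+1 = L *m (T *m L) ^+ m *m T.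
Proof.
elim: m => [|m IHm]; first by rewrite expr0 mulmx1 expr1.
by rewrite exprSr IHm -[LHS]/(_ *m _) exprSr -[_ * (T *m L)]/(_ *m _) !mulmxA.
Qed.

(* With A = L *m T a full rank factorization, T *m L is a nilpotent matrix of *)
(* smaller size with the same trace.                                          *)
Lemma nilpotent_mx (F : fieldType) (n k : nat) (A : 'M[F]_n) :
  A ^+ k = 0 -> \tr A = 0 /\ A ^+ n = 0.
Proof.
elim/ltn_ind: n k A => n IHn k A Ak0.
have [rn|rn] := eqVneq (\rank A) n.
  have Au : A \in unitmx by rewrite -row_free_unit /row_free rn.
  have : \rank (A ^+ k) = n.
    apply/eqP; rewrite -[_ == _]/(row_free (A ^+ k)) row_free_unit.
    elim: (k) => [|j IHj]; first by rewrite expr0 unitmx1.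
    by rewrite exprS unitmx_mul Au.
  rewrite Ak0 mxrank0 => n0; subst n.
  by split; [rewrite (flatmx0 A) mxtrace0 | apply: flatmx0].
have ltrn : (\rank A < n)%N by rewrite ltn_neqAle rn rank_leq_row.
pose L := col_base A; pose T := row_base A.
have defA : A = L *m T by rewrite mulmx_base.
have powA m : A ^+ m.+1 = L *m (T *m L) ^+ m *m T.
  by rewrite -mulmx_pow_swap -defA.
have powB : (T *m L) ^+ k.+2 = 0.
  rewrite exprS exprSr -![_ * _]/(_ *m _).
  have -> : T *m L *m ((T *m L) ^+ k *m (T *m L)) = T *m A ^+ k.+1 *m L.
    by rewrite powA !mulmxA.
  by rewrite exprS Ak0 mulr0 mulmx0 mul0mx.
have [trB Br] := IHn _ ltrn _ _ powB.
split; first by rewrite [in LHS]defA mxtrace_mulC.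
have -> : A ^+ n = A ^+ ((n.-1 - \rank A) + \rank A).+1.
  by congr (_ ^+ _); lia.
by rewrite powA exprD Br mulr0 mulmx0 mul0mx.
Qed.

Variables (R : realType) (n : nat).
Variable mu : 'cV[R]_n -> 'cV[R]_n -> 'cV[R]_n.

Definition ad_mx (x : 'cV[R]_n) : 'M[R]_n :=
  \matrix_(i, j) mu x (delta_mx j 0) i 0.

Lemma cV_sum_delta (v : 'cV[R]_n) : v = \sum_j v j 0 *: delta_mx j 0.
Proof.
apply/matrixP => i j; rewrite ord1 summxE (bigD1 i) //= !mxE !eqxx mulr1.
rewrite big1 ?addr0 // => k /negPf ki.
by rewrite !mxE eq_sym ki mulr0.
Qed.

Hypothesis mu_linl : forall y, linear (mu ^~ y).
Hypothesis mu_linr : forall x, linear (mu x).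

Lemma bracketDl x y z : mu (x + y) z = mu x z + mu y z.
Proof. by have := mu_linl z 1 x y; rewrite !scale1r. Qed.
Lemma bracketDr x y z : mu z (x + y) = mu z x + mu z y.
Proof. by have := mu_linr z 1 x y; rewrite !scale1r. Qed.
Lemma bracket0l z : mu 0 z = 0.
Proof. by apply: (addrI (mu 0 z)); rewrite -bracketDl !addr0. Qed.
Lemma bracket0r z : mu z 0 = 0.
Proof. by apply: (addrI (mu z 0)); rewrite -bracketDr !addr0. Qed.
Lemma bracketZl a x z : mu (a *: x) z = a *: mu x z.
Proof. by have := mu_linl z a x 0; rewrite bracket0l !addr0. Qed.
Lemma bracketZr a x z : mu z (a *: x) = a *: mu z x.
Proof. by have := mu_linr z a x 0; rewrite bracket0r !addr0. Qed.
Lemma bracketNl x z : mu (- x) z = - mu x z.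
Proof. by rewrite -scaleN1r bracketZl scaleN1r. Qed.
Lemma bracketNr x z : mu z (- x) = - mu z x.
Proof. by rewrite -scaleN1r bracketZr scaleN1r. Qed.
Lemma bracket_suml (I : Type) (r : seq I) (P : pred I) (F : I -> 'cV[R]_n) z :
  mu (\sum_(i <- r | P i) F i) z = \sum_(i <- r | P i) mu (F i) z.
Proof. exact: (big_morph (mu ^~ z) (fun x y => bracketDl x y z) (bracket0l z)).
  Qed.
Lemma bracket_sumr (I : Type) (r : seq I) (P : pred I) (F : I -> 'cV[R]_n) z :
  mu z (\sum_(i <- r | P i) F i) = \sum_(i <- r | P i) mu z (F i).
Proof. exact: (big_morph (mu z) (fun x y => bracketDr x y z) (bracket0r z)).
  Qed.
Lemma mul_ad_mx x v : ad_mx x *m v = mu x v.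
Proof.
rewrite [in RHS](cV_sum_delta v) bracket_sumr.
apply/matrixP => i j; rewrite ord1 mxE summxE.
by apply: eq_bigr => k _; rewrite bracketZr !mxE mulrC.
Qed.

Lemma mul_ad_mx_pow x k v : ad_mx x ^+ k *m v = iter k (mu x) v.
Proof.
elim: k => [|k IHk]; first by rewrite expr0 mul1mx.
by rewrite exprS -mulmxA IHk mul_ad_mx.
Qed.

Lemma bracket_lower_central k x v :
  v \in lower_central mu k -> mu x v \in lower_central mu k.+1.
Proof.
move=> vk /=.
rewrite (coord_vbasis (memvf x)) (coord_vbasis vk) bracket_suml.
apply: memv_suml => i _; rewrite bracket_sumr.
apply: memv_suml => j _; rewrite bracketZl bracketZr.
do 2!apply: memvZ; apply: memv_span; apply/allpairsPdep.
by exists (vbasis fullv)`_i, (vbasis (lower_central mu k))`_j; split => //;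
   rewrite mem_nth // size_tuple.
Qed.

Hypothesis mu_nil : exists k, lower_central mu k = 0%VS.

Lemma lower_central_eventually0 :
  exists k, forall m v, v \in lower_central mu (m + k) -> v = 0.
Proof.
have [k k0] := mu_nil; exists k; elim=> [|m IHm] v.
  by rewrite k0 memv0 => /eqP.
rewrite addSn /=; set U := <<_>>%VS; suff -> : U = 0%VS by rewrite memv0 =>
  /eqP.
apply/eqP; rewrite -subv0 /U; apply/span_subvP => w.
case/allpairsPdep => a [b [_ bm ->]].
have -> : b = 0 by apply: IHm; apply: vbasis_mem.
by rewrite bracket0r mem0v.
Qed.

Lemma nilpotent_ad_mx x : exists k, ad_mx x ^+ k = 0.
Proof.
have [k kP] := lower_central_eventually0; exists k.
apply/matrixP => i j.
have H (v : 'cV[R]_n) : ad_mx x ^+ k *m v = 0.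
  rewrite mul_ad_mx_pow; apply: (kP 0%N); rewrite add0n.
  elim: (k) => [|m IHm]; [exact: memvf | exact: bracket_lower_central].
by have := congr1 (fun M : 'cV_n => M i 0) (H (delta_mx j 0));
  rewrite -colE !mxE.
Qed.

Lemma nilpotent_ad_mx_mul x y : exists k, (ad_mx x *m ad_mx y) ^+ k = 0.
Proof.
have [k kP] := lower_central_eventually0; exists k.
apply/matrixP => i j; 
have H (v : 'cV[R]_n) : (ad_mx x *m ad_mx y) ^+ k *m v = 0.
  (* Each factor $\operatorname{ad}_x\operatorname{ad}_y$ descends two steps of the lower central
     series, so $k$ factors land in the term of index [k + k]. *)
  apply: (kP k).
  elim: (k) => [|m IHm]; first exact: memvf.
  rewrite exprS -mulmxA -[X in X \in _]mulmxA !mul_ad_mx addSn addnS.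
  by do 2!apply: bracket_lower_central.
by have := congr1 (fun M : 'cV_n => M i 0) (H (delta_mx j 0));
  rewrite -colE !mxE.
Qed.

Lemma tr_ad_mx x : \tr (ad_mx x) = 0.
Proof. by have [k /nilpotent_mx[]] := nilpotent_ad_mx x. Qed.

(** The Killing form of a nilpotent Lie algebra vanishes. Together with [tr_ad_mx] (unimodularity),
    this removes most contractions from the Ricci tensor. *)
Lemma tr_ad_mx_mul x y : \tr (ad_mx x *m ad_mx y) = 0.
Proof. by have [k /nilpotent_mx[]] := nilpotent_ad_mx_mul x y. Qed.

(** The exponent is the dimension, whatever the nilpotency step, which fits the truncation of [bch]
    at length [n]. *)
Lemma ad_mx_pow_dim x : ad_mx x ^+ n = 0.
Proof. by have [k /nilpotent_mx[]] := nilpotent_ad_mx x. Qed.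

End NilpotentBracket.

(** * Directional derivatives of matrix-valued maps *)

Section DeriveMatrix.
Variables (R : realType) (V : normedModType R).
Implicit Types (x v : V).

Lemma is_deriveM_fun (f g : V -> R) x v df dg :
  is_derive x v f df -> is_derive x v g dg ->
  is_derive x v (fun y => f y * g y) (df * g x + f x * dg).
Proof.
move=> Hf Hg.
have -> : df * g x + f x * dg = f x *: dg + g x *: df.
  by rewrite addrC [df * _]mulrC.
exact: is_deriveM.
Qed.

Lemma is_derive_bigsum (W : normedModType R) (I : Type) (r : seq I)
    (P : pred I) (f : I -> V -> W) x v (df : I -> W) :
  (forall i, P i -> is_derive x v (f i) (df i)) ->
  is_derive x v (\sum_(i <- r | P i) f i) (\sum_(i <- r | P i) df i).
Proof.
move=> Hf; elim: r => [|i r IHr]; first by rewrite !big_nil;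
  exact: is_derive_cst.
rewrite !big_cons; case Pi: (P i) => //.
by apply: is_deriveD => //; apply: Hf.
Qed.

Lemma is_derive_sum_fun (I : Type) (r : seq I) (P : pred I) (f : I -> V -> R)
    x v (df : I -> R) :
  (forall i, P i -> is_derive x v (f i) (df i)) ->
  is_derive x v (fun y => \sum_(i <- r | P i) f i y) (\sum_(i <- r | P i) df i).
Proof.
move=> Hf.
have -> : (fun y => \sum_(i <- r | P i) f i y) = \sum_(i <- r | P i) f i.
  by apply/funext => y; rewrite fct_sumE.
exact: is_derive_bigsum.
Qed.

Lemma is_derive_mxP (m n : nat) (M : V -> 'M[R]_(m, n)) x v dM :
  is_derive x v M dM <->
  forall i j, is_derive x v (fun y => M y i j) (dM i j).
Proof.
split=> [HM i j|HM].
  have Md : derivable M x v by [].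
  apply: DeriveDef; first exact: (derivable_mxP _ _ _).1.
  have := derive_mx Md; rewrite derive_val => ->.
  by rewrite mxE.
have Md : derivable M x v by apply/derivable_mxP => i j; case: (HM i j).
apply: DeriveDef => //; rewrite derive_mx //.
by apply/matrixP => i j; rewrite mxE derive_val.
Qed.

Lemma is_derive_mulmx (m n p : nat) (M : V -> 'M[R]_(m, n))
    (N : V -> 'M[R]_(n, p)) x v dM dN :
  is_derive x v M dM -> is_derive x v N dN ->
  is_derive x v (fun y => M y *m N y) (dM *m N x + M x *m dN).
Proof.
move=> /is_derive_mxP HM /is_derive_mxP HN; apply/is_derive_mxP => i j.
under eq_fun do rewrite mxE.
rewrite !mxE -big_split /=; apply: is_derive_sum_fun => k _.
exact: is_deriveM_fun.
Qed.

Lemma is_derive_trmx (m n : nat) (M : V -> 'M[R]_(m, n)) x v dM :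
  is_derive x v M dM -> is_derive x v (fun y => (M y)^T) dM^T.
Proof.
move=> /is_derive_mxP HM; apply/is_derive_mxP => i j.
by under eq_fun do rewrite mxE; rewrite mxE.
Qed.

End DeriveMatrix.

Lemma invmx_entry (R : comUnitRingType) n (M : 'M[R]_n) i j :
  M \in unitmx -> invmx M i j = (\det M)^-1 * (\adj M) i j.
Proof. by move=> Mu; rewrite /invmx Mu mxE. Qed.

(** * Classes of real functions closed under sums and products *)

Section RingClosedFunctions.
Variables (R : realType) (T : Type) (S : (T -> R) -> Prop).
Hypothesis Scst : forall c, S (fun=> c).
Hypothesis SD : forall f g, S f -> S g -> S (fun x => f x + g x).
Hypothesis SM : forall f g, S f -> S g -> S (fun x => f x * g x).

Let Sext f g : f =1 g -> S g -> S f.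
Proof. by move=> /funext ->. Qed.

(** [S] stands in turn for derivability at a point, [polyfun], right continuity at $0$ and
    convergent polynomial families; [T] is arbitrary so that its elements may pair a time with a
    point. *)
Lemma ring_closed_sum (I : Type) (r : seq I) (P : pred I) (f : I -> T -> R) :
  (forall i, P i -> S (f i)) -> S (fun x => \sum_(i <- r | P i) f i x).
Proof.
move=> Hf; elim: r => [|i r IHr].
  by apply: Sext (Scst _) => x; rewrite big_nil.
apply: (Sext (fun x => big_cons _ _ _ _ _ _)).
by case Pi: (P i) => //; apply: SD => //; apply: Hf.
Qed.

Lemma ring_closed_prod (I : Type) (r : seq I) (P : pred I) (f : I -> T -> R) :
  (forall i, P i -> S (f i)) -> S (fun x => \prod_(i <- r | P i) f i x).
Proof.
move=> Hf; elim: r => [|i r IHr].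
  by apply: Sext (Scst _) => x; rewrite big_nil.
apply: (Sext (fun x => big_cons _ _ _ _ _ _)).
by case Pi: (P i) => //; apply: SM => //; apply: Hf.
Qed.

Lemma ring_closed_mulmx (m n p : nat) (M : T -> 'M[R]_(m, n))
    (N : T -> 'M[R]_(n, p)) :
  (forall i j, S (fun x => M x i j)) -> (forall i j, S (fun x => N x i j)) ->
  forall i j, S (fun x => (M x *m N x) i j).
Proof.
move=> HM HN i j; apply: (Sext (fun x => mxE _ _ _ _)).
by apply: ring_closed_sum => k _; apply: SM.
Qed.

Lemma ring_closed_det n (M : T -> 'M[R]_n) :
  (forall i j, S (fun x => M x i j)) -> S (fun x => \det (M x)).
Proof.
move=> HM; apply: ring_closed_sum => s _; apply: SM; first exact: Scst.
by apply: ring_closed_prod => i _.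
Qed.

Lemma ring_closed_adj n (M : T -> 'M[R]_n) i j :
  (forall i j, S (fun x => M x i j)) -> S (fun x => (\adj (M x)) i j).
Proof.
move=> HM; apply: (Sext (fun x => mxE _ _ _ _)).
apply: SM; first exact: Scst.
apply: ring_closed_det => k l.
by apply: (Sext _ (HM (lift j k) (lift i l))) => x; rewrite !mxE.
Qed.

End RingClosedFunctions.

Section DeriveInverse.
Variables (R : realType) (V : normedModType R).

(** Derivability comes from the cofactor formula; the value then follows by differentiating $M
    M^{-1} = 1$. *)
Lemma is_derive_invmx n (M : V -> 'M[R]_n) x v dM :
  (\forall y \near x, M y \in unitmx) -> is_derive x v M dM ->
  is_derive x v (fun y => invmx (M y)) (- (invmx (M x) *m dM *m invmx (M x))).
Proof.
move=> Mu HM; have Mxu : M x \in unitmx by apply: nbhs_singleton Mu.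
(* [invmx] returns a singular matrix unchanged. [W] is the cofactor formula without that case
   distinction, and agrees with [invmx] near [x]. *)
pose W y := (\det (M y))^-1 *: \adj (M y).
have WE : \forall y \near x, W y = invmx (M y).
  by near=> y; rewrite /W /invmx ifT //; near: y.
have HM' i j : derivable (fun y => M y i j) x v by case:
  ((is_derive_mxP M x v dM).1 HM i j).
have Wd : derivable W x v.
  apply/derivable_mxP => i j; under eq_fun do rewrite mxE.
  apply: derivableM.
    apply: derivableV; first by rewrite -unitfE -unitmxE.
    apply: (@ring_closed_det _ _ (fun f => derivable f x v)) => //.
    - by move=> f g; apply: derivableD.
    - by move=> f g; apply: derivableM.
  apply: (@ring_closed_adj _ _ (fun f => derivable f x v)) => //.
  - by move=> f g; apply: derivableD.
  - by move=> f g; apply: derivableM.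
have /derivableP HW := Wd.
have MW0 : dM *m W x + M x *m 'D_v W x = 0.
  have [_ <-] := is_derive_mulmx HM HW.
  rewrite (@near_eq_derive _ _ _ _ (cst 1%:M)) ?derive_cst //.
  by near=> y; rewrite (near WE y) // mulmxV //; near: y.
apply: (near_eq_is_derive WE).
have -> : - (invmx (M x) *m dM *m invmx (M x)) = 'D_v W x => //.
have := congr1 (mulmx (invmx (M x))) MW0.
rewrite mulmxDr mulmx0 (nbhs_singleton WE) !mulmxA mulVmx // mul1mx.
by move/eqP; rewrite addr_eq0 => /eqP ->; rewrite opprK.
Unshelve. all: by end_near. Qed.

End DeriveInverse.

(** * Dynkin's coefficients as computable sums *)

Section BchCoefficients.

Definition bch_word (s : seq (nat * nat)) : seq bool :=
  flatten [seq nseq p.1 false ++ nseq p.2 true | p <- s].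

(* Letters false and true stand for - x and y. At y = x the iterated bracket  *)
(* of the word w is [word_value w] times x, and its derivative in the         *)
(* direction v of y is [word_slope w] times ad_x^(size w - 1) v.              *)
Definition word_value (w : seq bool) : int :=
  if w is [:: b] then (if b then 1 else -1) else 0.

Fixpoint word_slope (w : seq bool) : int :=
  match w with
  | [::] => 0
  | [:: b] => if b then 1 else 0
  | b :: w' => if b then word_slope w' - word_value w' else - word_slope w'
  end.

(** Replaces the finite functions that index the sum in [bch]: lists of pairs can be evaluated by
    [vm_compute]. *)
Fixpoint pair_seqs (m d : nat) : seq (seq (nat * nat)) :=
  if m is m'.+1 then
    [seq p :: s | p <- [seq (i, j) | i <- iota 0 d, j <- iota 0 d],
                  s <- pair_seqs m' d]
  else [:: [::]].

Lemma mem_pair_seqs m d s : (s \in pair_seqs m d) =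
  (size s == m) && all (fun p => (p.1 < d)%N && (p.2 < d)%N) s.
Proof.
elim: m s => [|m IHm] s /=; first by rewrite inE; case: s.
apply/allpairsP/idP => [[[p s'] /= [pin s'in ->]]|].
  move: s'in; rewrite IHm /= eqSS => /andP[-> ->]; rewrite andbT.
  by case/allpairsP: pin => -[i j] /= [+ + ->] /=;
    rewrite !mem_iota !add0n /= => -> ->.
case: s => [//|p s] /=; rewrite eqSS => /andP[sm /andP[/andP[p1 p2] sd]].
exists (p, s); split => //=; last by rewrite IHm sm.
by apply/allpairsP; exists p; rewrite !mem_iota !add0n p1 p2; split => //;
  case: (p).
Qed.

Lemma uniq_pair_seqs m d : uniq (pair_seqs m d).
Proof.
elim: m => [//|m IHm] /=; apply: allpairs_uniq => //.
  by apply: allpairs_uniq; rewrite ?iota_uniq // => -[a b] [c e] _ _ [-> ->].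
by move=> [a b] [c e] _ _ [-> ->].
Qed.

Definition exponents m d (rs : {ffun 'I_m -> 'I_d * 'I_d}) : seq (nat * nat) :=
  [seq (val (rs k).1, val (rs k).2) | k <- enum 'I_m].

Lemma exponents_inj m d : injective (@exponents m d).
Proof.
move=> rs rs' /eq_in_map E; apply/ffunP => k.
have := E k (mem_enum _ k); case: (rs k) => a b; case: (rs' k) => a' b' /= [].
by move=> /val_inj -> /val_inj ->.
Qed.

Lemma big_exponents (V : nmodType) m d (P : pred (seq (nat * nat)))
    (F : seq (nat * nat) -> V) :
  \sum_(rs : {ffun 'I_m -> 'I_d * 'I_d} | P (exponents rs)) F (exponents rs) =
  \sum_(s <- pair_seqs m d | P s) F s.
Proof.
rewrite -(big_map (@exponents m d) P F) /=.
apply: perm_big; apply: uniq_perm; rewrite ?uniq_pair_seqs //.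
  by rewrite map_inj_uniq ?index_enum_uniq //; apply: exponents_inj.
move=> s; rewrite mem_pair_seqs;
  apply/mapP/idP => [[rs _ ->]|/andP[/eqP sm /allP sd]].
  rewrite size_map size_enum_ord eqxx; apply/allP => p /mapP[k _ ->] /=.
  by rewrite !ltn_ord.
have lt (k : 'I_m) :
    ((nth (0, 0) s k).1 < d)%N && ((nth (0, 0) s k).2 < d)%N.
  by apply: sd; rewrite mem_nth // sm.
have lt1 k := proj1 (andP (lt k)); have lt2 k := proj2 (andP (lt k)).
exists [ffun k => (Ordinal (lt1 k), Ordinal (lt2 k))];
  first by rewrite mem_index_enum.
apply: (@eq_from_nth _ (0, 0)); first by rewrite size_map size_enum_ord.
move=> i; rewrite sm => ltim.
rewrite (nth_map (Ordinal ltim)) ?size_enum_ord // ffunE /= nth_enum_ord //.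
by case: nth.
Qed.

Definition bch_cond d (s : seq (nat * nat)) : bool :=
  all (fun p => 0 < p.1 + p.2)%N s && (sumn [seq (p.1 + p.2)%N | p <- s] == d).

Definition fact_prod (s : seq (nat * nat)) : nat :=
  foldr muln 1%N [seq (p.1`! * p.2`!)%N | p <- s].

(** Only natural numbers and integers are kept, so that the list can be computed outright; signs and
    denominators are left to [bch_coef]. *)
Definition bch_terms m d : seq (nat * int) :=
  [seq (fact_prod s, word_slope (bch_word s)) | s <- pair_seqs m d.+1 &
    bch_cond d s].
Definition bch_coef (R : realType) d : R :=
  \sum_(1 <= m < d.+1) \sum_(p <- bch_terms m d)
    (-1) ^+ m.-1 / (m * d * p.1)%N%:R * p.2%:~R.

(** Curvature at the origin sees the metric to second order, hence only the coefficients of $1$,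
    $\operatorname{ad}_x$ and $\operatorname{ad}_x^2$. Once the index lists are evaluated, each is a
    finite rational sum. *)
Lemma bch_coef1 (R : realType) : bch_coef R 1 = 1.
Proof.
rewrite /bch_coef big_nat1.
set t1 := bch_terms 1 _; vm_compute in t1.
rewrite /t1 !big_cons !big_nil /=.
by field.
Qed.

Lemma bch_coef2 (R : realType) : bch_coef R 2 = - 2^-1.
Proof.
rewrite /bch_coef big_nat_recr // big_nat_recr // big_geq //.
set t1 := bch_terms 1 _; vm_compute in t1; set t2 := bch_terms 2 _;
  vm_compute in t2.
rewrite /t1 /t2 !big_cons !big_nil /=.
by field.
Qed.

Lemma bch_coef3 (R : realType) : bch_coef R 3 = 6^-1.
Proof.
rewrite /bch_coef big_nat_recr // big_nat_recr // big_nat_recr // big_geq //.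
set t1 := bch_terms 1 _; vm_compute in t1; set t2 := bch_terms 2 _;
  vm_compute in t2; set t3 := bch_terms 3 _; vm_compute in t3.
rewrite /t1 /t2 /t3 !big_cons !big_nil /=.
by field.
Qed.

End BchCoefficients.

(** * Derivative of left translation by the inverse *)

Section BchDerivative.
Variables (R : realType) (n : nat).
Variable mu : 'cV[R]_n -> 'cV[R]_n -> 'cV[R]_n.
Hypothesis mu_linl : forall y, linear (mu ^~ y).
Hypothesis mu_linr : forall x, linear (mu x).
Hypothesis mu_skew : forall x y, mu x y = - mu y x.

Lemma bracket_self x : mu x x = 0.
Proof.
have /eqP := mu_skew x x; rewrite -addr_eq0 -mulr2n -scaler_nat scaler_eq0.
by rewrite pnatr_eq0 /= => /eqP.
Qed.

Lemma is_derive_bracket (V : normedModType R) (u w : V -> 'cV[R]_n) x v du dw :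
  is_derive x v u du -> is_derive x v w dw ->
  is_derive x v (fun y => mu (u y) (w y)) (mu du (w x) + mu (u x) dw).
Proof.
move=> Hu Hw.
have Had : is_derive x v (fun y => ad_mx mu (u y)) (ad_mx mu du).
  apply/is_derive_mxP => i j.
  have E z : ad_mx mu z i j = \sum_k z k 0 * ad_mx mu (delta_mx k 0) i j.
    rewrite [in LHS](cV_sum_delta z) mxE bracket_suml // summxE.
    by apply: eq_bigr => k _; rewrite bracketZl // !mxE.
  under eq_fun do rewrite E.
  rewrite E; apply: is_derive_sum_fun => k _.
  have := is_deriveM_fun ((is_derive_mxP _ _ _ _).1 Hu k 0)
    (is_derive_cst (ad_mx mu (delta_mx k 0) i j : R) x v).
  by rewrite mulr0 addr0.
have := is_derive_mulmx Had Hw.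
by under eq_fun do rewrite mul_ad_mx //; rewrite !mul_ad_mx.
Qed.

Definition bch_letter (x y : 'cV[R]_n) (b : bool) := if b then y else - x.

(** On the diagonal every letter is $\pm x$, so the innermost bracket kills each word of length at
    least two. *)
Lemma iter_bracket_word x w :
  iter_bracket mu [seq bch_letter x x b | b <- w] = (word_value w)%:~R *: x.
Proof.
case: w => [|b [|b' w]]; first by rewrite scale0r.
  by case: b; rewrite /= ?scale1r ?scaleN1r.
rewrite scale0r; elim: w b b' => [|c w IHw] b b'.
  by case: b b' => -[]; rewrite /= ?bracketNl ?bracketNr // bracket_self ?oppr0.
by rewrite [map _ _]/= [LHS]/=
  -[X in mu _ X]/(iter_bracket mu [seq _ | b <- [:: b', c & w]]) IHw bracket0r.
Qed.

Lemma is_derive_iter_bracket x v w :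
  is_derive x v (fun y => iter_bracket mu [seq bch_letter x y b | b <- w])
    ((word_slope w)%:~R *: iter (size w).-1 (mu x) v).
Proof.
have Hl b : is_derive x v (fun y => bch_letter x y b) (if b then v else 0).
  by case: b; [exact: is_derive_id | exact: is_derive_cst].
elim: w => [|b w IHw]; first by rewrite scale0r; exact: is_derive_cst.
case: w IHw => [|c w] IHw.
  by have := Hl b; case: (b); rewrite /= ?scale1r ?scale0r.
have := is_derive_bracket (Hl b) IHw; rewrite iter_bracket_word.
set W := iter _ _ _; set s := word_slope (c :: w); set t := word_value (c :: w).
have -> : iter (size [:: b, c & w]).-1 (mu x) v = mu x W by [].
(* Differentiating the leading letter leaves $[v, t x]$. The factor [t] is zero unless a single
   letter remains, in which case [W] is [v]; this explains the [word_value] subtracted in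
   [word_slope]. *)
have vW : mu v (t%:~R *: x) = - (t%:~R *: mu x W).
  rewrite bracketZr // mu_skew scalerN /W /t.
  by case: (w) => //= *; rewrite !scale0r.
rewrite [word_slope _]/= -/s -/t; case: b.
  by rewrite vW bracketZr // rmorphB /= scalerBl addrC.
by rewrite bracket0l // add0r bracketNl // bracketZr // rmorphN /= scaleNr.
Qed.

Lemma bch_words x y : bch mu (- x) y =
  \sum_(1 <= d < n.+1) \sum_(1 <= m < d.+1)
    \sum_(s <- pair_seqs m d.+1 | bch_cond d s)
      ((-1) ^+ m.-1 / (m * d * fact_prod s)%N%:R) *:
        iter_bracket mu [seq bch_letter x y b | b <- bch_word s].
Proof.
rewrite /bch; apply: eq_bigr => d _; apply: eq_bigr => m _.
rewrite -big_exponents; apply: eq_big => [rs|rs _].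
  rewrite /bch_cond /exponents all_map -map_comp sumnE big_map big_enum /=.
  congr (_ && _); apply/forallP/allP => H k; first by move=> _; apply: H.
  by apply: H; rewrite mem_enum.
congr (_ *: iter_bracket mu _).
  congr (_ / _%:R); congr (_ * _)%N.
  by rewrite /fact_prod foldrE /exponents -map_comp big_map big_enum.
rewrite /bch_word /exponents map_flatten -!map_comp; congr flatten.
by apply: eq_map => k /=; rewrite map_cat !map_nseq.
Qed.

Lemma size_bch_word d s : bch_cond d s -> size (bch_word s) = d.
Proof.
case/andP => _ /eqP <-; rewrite size_flatten /shape -map_comp; congr sumn.
by apply: eq_map => p /=; rewrite size_cat !size_nseq.
Qed.

(* The coefficients are those of (1 - exp (- ad_x)) / ad_x, of which only the *)
(* first three matter.                                                        *)
Lemma is_derive_bch x v : is_derive x v (bch mu (- x))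
  (\sum_(d < n) bch_coef R d.+1 *: iter d (mu x) v).
Proof.
have -> : bch mu (- x) = \sum_(1 <= d < n.+1) \sum_(1 <= m < d.+1)
    \sum_(s <- pair_seqs m d.+1 | bch_cond d s)
      (fun y => ((-1) ^+ m.-1 / (m * d * fact_prod s)%N%:R) *:
        iter_bracket mu [seq bch_letter x y b | b <- bch_word s]).
  apply/funext => y; rewrite bch_words fct_sumE; apply: eq_bigr => d _.
  by rewrite fct_sumE; apply: eq_bigr => m _; rewrite fct_sumE.
rewrite -(big_mkord xpredT (fun d => bch_coef R d.+1 *: iter d (mu x) v)).
rewrite -(big_add1 _ _ 0 n.+1 xpredT
  (fun d => bch_coef R d *: iter d.-1 (mu x) v)).
apply: is_derive_bigsum => d _; rewrite /bch_coef scaler_suml;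
  apply: is_derive_bigsum => m _.
rewrite big_map big_filter scaler_suml;
  apply: is_derive_bigsum => s /size_bch_word sd.
rewrite -scalerA -sd; apply: is_deriveZ; exact: is_derive_iter_bracket.
Qed.

Lemma bch_self x : bch mu (- x) x = 0.
Proof.
rewrite bch_words big_nat_cond big1 // => d /andP[/andP[d0 _] _].
have [->|d1] := eqVneq d 1%N; last first.
  rewrite big1 // => m _; rewrite big1 // => s /size_bch_word sd.
  rewrite iter_bracket_word; move: sd; case: bch_word => [|b [|c w]] /= sd.
  - by rewrite scale0r scaler0.
  - by rewrite -sd in d1.
  by rewrite scale0r scaler0.
(* In length one only the words $-x$ and $y$ occur, and they cancel at $y = x$. *)
rewrite big_nat1 -big_filter.
set l := [seq i <- _ | _]; vm_compute in l; rewrite /l !big_cons big_nil /=.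
by rewrite addr0 -scalerDr addrN scaler0.
Qed.

End BchDerivative.

(** * Polynomial functions and their 2-jets at the origin *)

Section PolynomialFunctions.
Variables (R : realType) (n : nat).
Implicit Types (f g : 'cV[R]_n -> R).

Inductive polyfun : ('cV[R]_n -> R) -> Prop :=
| polyfun_cst c : polyfun (fun=> c)
| polyfun_coord k : polyfun (fun x => x k 0)
| polyfunD f g : polyfun f -> polyfun g -> polyfun (fun x => f x + g x)
| polyfunM f g : polyfun f -> polyfun g -> polyfun (fun x => f x * g x).

Lemma polyfun_differentiable f x : polyfun f -> differentiable f x.
Proof.
elim=> [c|k|{}f g _ df _ dg|{}f g _ df _ dg].
- exact: differentiable_cst.
- exact: differentiable_coord.
- exact: differentiableD.
- exact: differentiableM.
Qed.

Lemma polyfun_derivable f x v : polyfun f -> derivable f x v.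
Proof. by move=> pf; apply/diff_derivable/polyfun_differentiable. Qed.

Lemma partial_cst i c : partial i (fun=> c : R) = (fun=> 0) :> ('cV[R]_n -> R).
Proof. by apply/funext => x; rewrite /partial derive_cst. Qed.

Lemma partial_coord i k :
  partial i (fun x : 'cV[R]_n => x k 0) = fun=> (k == i)%:R.
Proof.
apply/funext => x; rewrite /partial.
have /is_derive_mxP/(_ k 0)[_ ->] := is_derive_id x (delta_mx i 0 : 'cV[R]_n).
by rewrite mxE eqxx andbT.
Qed.

Lemma partialD i f g : polyfun f -> polyfun g ->
  partial i (fun x => f x + g x) = fun x => partial i f x + partial i g x.
Proof.
move=> pf pg; apply/funext => x; rewrite /partial.
by apply: deriveD; apply: polyfun_derivable.
Qed.

Lemma partialM i f g : polyfun f -> polyfun g ->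
  partial i (fun x => f x * g x) =
  fun x => partial i f x * g x + f x * partial i g x.
Proof.
move=> pf pg; apply/funext => x; rewrite /partial.
by case: (is_deriveM_fun (derivableP (@polyfun_derivable _ x (delta_mx i 0) pf))
   (derivableP (@polyfun_derivable _ x (delta_mx i 0) pg))).
Qed.

Lemma polyfun_partial i f : polyfun f -> polyfun (partial i f).
Proof.
elim=> [c|k|{}f g pf df pg dg|{}f g pf df pg dg].
- by rewrite partial_cst; apply: polyfun_cst.
- by rewrite partial_coord; apply: polyfun_cst.
- by rewrite partialD //; apply: polyfunD.
- by rewrite partialM //; apply: polyfunD; apply: polyfunM.
Qed.

(** [polyfun] is bundled because the sum and Leibniz rules require derivable arguments, also after
    one differentiation. *)
Definition jet2 f (c0 : R) (c1 : 'I_n -> R) (c2 : 'I_n -> 'I_n -> R) : Prop :=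
  [/\ polyfun f, f 0 = c0, forall k, partial k f 0 = c1 k &
      forall k l, partial k (partial l f) 0 = c2 k l].

Lemma jet2_eq f c0 c1 c2 d0 d1 d2 : jet2 f c0 c1 c2 ->
  c0 = d0 -> c1 =1 d1 -> c2 =2 d2 -> jet2 f d0 d1 d2.
Proof.
by move=> [pf f0 f1 f2] <- e1 e2; split=> // k *; rewrite ?f1 ?f2 ?e1 ?e2.
Qed.

Lemma jet2_polyfun f : polyfun f ->
  jet2 f (f 0) (fun k => partial k f 0) (fun k l => partial k (partial l f) 0).
Proof. by split. Qed.

Lemma jet2_cst c : jet2 (fun=> c) c (fun=> 0) (fun _ _ => 0).
Proof.
split=> [||k|k l]; rewrite ?partial_cst //.
exact: polyfun_cst.
Qed.
Lemma jet2_coord i : jet2 (fun x => x i 0) 0 (fun k => (i == k)%:R)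
  (fun _ _ => 0).
Proof.
split=> [||k|k l]; rewrite ?partial_coord ?partial_cst ?mxE //.
exact: polyfun_coord.
Qed.

Lemma jet2D f g c0 c1 c2 d0 d1 d2 : jet2 f c0 c1 c2 -> jet2 g d0 d1 d2 ->
  jet2 (fun x => f x + g x) (c0 + d0) (fun k => c1 k + d1 k)
    (fun k l => c2 k l + d2 k l).
Proof.
move=> [pf f0 f1 f2] [pg g0 g1 g2]; split=> [||k|k l].
- exact: polyfunD.
- by rewrite f0 g0.
- by rewrite partialD // f1 g1.
rewrite partialD // partialD; [by rewrite f2 g2| |]; exact: polyfun_partial.
Qed.

Lemma jet2M f g c0 c1 c2 d0 d1 d2 : jet2 f c0 c1 c2 -> jet2 g d0 d1 d2 ->
  jet2 (fun x => f x * g x) (c0 * d0) (fun k => c1 k * d0 + c0 * d1 k)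
    (fun k l => c2 k l * d0 + c1 k * d1 l + c1 l * d1 k + c0 * d2 k l).
Proof.
move=> [pf f0 f1 f2] [pg g0 g1 g2]; have pp := polyfun_partial.
split=> [||k|k l].
- exact: polyfunM.
- by rewrite f0 g0.
- by rewrite partialM // f1 g1 f0 g0.
rewrite partialM // partialD; [|by apply: polyfunM; auto..].
rewrite !partialM; auto; rewrite !(f0, f1, f2, g0, g1, g2); ring.
Qed.

Lemma jet2_sum (I : Type) (r : seq I) (f : I -> 'cV[R]_n -> R) c0 c1 c2 :
  (forall i, jet2 (f i) (c0 i) (c1 i) (c2 i)) ->
  jet2 (fun x => \sum_(i <- r) f i x) (\sum_(i <- r) c0 i)
    (fun k => \sum_(i <- r) c1 i k) (fun k l => \sum_(i <- r) c2 i k l).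
Proof.
move=> Hf; elim: r => [|i r IHr].
  have -> : (fun x => \sum_(i <- [::]) f i x) = fun=> 0.
    by apply/funext => x; rewrite big_nil.
  by apply: jet2_eq (jet2_cst 0) _ _ _ => [|k|k l]; rewrite big_nil.
have -> : (fun x => \sum_(j <- i :: r) f j x) =
    fun x => f i x + \sum_(j <- r) f j x.
  by apply/funext => x; rewrite big_cons.
by apply: jet2_eq (jet2D (Hf i) IHr) _ _ _ => [|k|k l]; rewrite big_cons.
Qed.

Definition mxjet2 (m p : nat) (M : 'cV[R]_n -> 'M[R]_(m, p)) (M0 : 'M[R]_(m, p))
    (M1 : 'I_n -> 'M[R]_(m, p)) (M2 : 'I_n -> 'I_n -> 'M[R]_(m, p)) : Prop :=
  forall i j, jet2 (fun x => M x i j) (M0 i j) (fun k => M1 k i j)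
    (fun k l => M2 k l i j).

Lemma mxjet2_eq m p (M : 'cV[R]_n -> 'M[R]_(m, p)) M0 M1 M2 N0 N1 N2 :
  mxjet2 M M0 M1 M2 -> M0 = N0 -> M1 =1 N1 -> M2 =2 N2 -> mxjet2 M N0 N1 N2.
Proof.
move=> HM <- e1 e2 i j.
by apply: jet2_eq (HM i j) _ _ _ => // [k|k l]; rewrite ?e1 ?e2.
Qed.

Lemma mxjet2_polyfun m p (M : 'cV[R]_n -> 'M[R]_(m, p)) :
  (forall i j, polyfun (fun x => M x i j)) ->
  exists M0 M1 M2, mxjet2 M M0 M1 M2.
Proof.
move=> pM; exists (M 0), (fun k =>
  \matrix_(i, j) partial k (fun x => M x i j) 0),
  (fun k l => \matrix_(i, j) partial k (partial l (fun x => M x i j)) 0) => i j.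
by apply: jet2_eq (jet2_polyfun (pM i j)) _ _ _ => [|k|k l]; rewrite ?mxE.
Qed.

Lemma mxjet2_cst m p (A : 'M[R]_(m, p)) :
  mxjet2 (fun=> A) A (fun=> 0) (fun _ _ => 0).
Proof.
by move=> i j; apply: jet2_eq (jet2_cst _) _ _ _ => [|k|k l]; rewrite ?mxE.
Qed.

Lemma mxjet2D m p (M N : 'cV[R]_n -> 'M[R]_(m, p)) M0 M1 M2 N0 N1 N2 :
  mxjet2 M M0 M1 M2 -> mxjet2 N N0 N1 N2 ->
  mxjet2 (fun x => M x + N x) (M0 + N0) (fun k => M1 k + N1 k)
    (fun k l => M2 k l + N2 k l).
Proof.
move=> HM HN i j; have -> : (fun x => (M x + N x) i j) = fun x =>
  M x i j + N x i j.
  by apply/funext => x; rewrite mxE.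
by apply: jet2_eq (jet2D (HM i j) (HN i j)) _ _ _ => [|k|k l]; rewrite mxE.
Qed.

Lemma mxjet2Z m p (c : R) (M : 'cV[R]_n -> 'M[R]_(m, p)) M0 M1 M2 :
  mxjet2 M M0 M1 M2 ->
  mxjet2 (fun x => c *: M x) (c *: M0) (fun k => c *: M1 k)
    (fun k l => c *: M2 k l).
Proof.
move=> HM i j; have -> : (fun x => (c *: M x) i j) = fun x => c * M x i j.
  by apply/funext => x; rewrite mxE.
apply: jet2_eq (jet2M (jet2_cst c) (HM i j)) _ _ _ => [|k|k l];
  by rewrite mxE ?mul0r ?addr0 ?add0r.
Qed.

Lemma mxjet2T m p (M : 'cV[R]_n -> 'M[R]_(m, p)) M0 M1 M2 :
  mxjet2 M M0 M1 M2 ->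
  mxjet2 (fun x => (M x)^T) M0^T (fun k => (M1 k)^T) (fun k l => (M2 k l)^T).
Proof.
move=> HM i j; have -> : (fun x => (M x)^T i j) = fun x => M x j i.
  by apply/funext => x; rewrite mxE.
by apply: jet2_eq (HM j i) _ _ _ => [|k|k l]; rewrite mxE.
Qed.
Lemma mxjet2M m p q (M : 'cV[R]_n -> 'M[R]_(m, p))
  (N : 'cV[R]_n -> 'M[R]_(p, q))
    M0 M1 M2 N0 N1 N2 :
  mxjet2 M M0 M1 M2 -> mxjet2 N N0 N1 N2 ->
  mxjet2 (fun x => M x *m N x) (M0 *m N0) (fun k => M1 k *m N0 + M0 *m N1 k)
    (fun k l => M2 k l *m N0 + M1 k *m N1 l + M1 l *m N1 k + M0 *m N2 k l).
Proof.
move=> HM HN i j.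
have -> : (fun x => (M x *m N x) i j) = fun x => \sum_k M x i k * N x k j.
  by apply/funext => x; rewrite mxE.
apply: jet2_eq (jet2_sum _ (fun k => jet2M (HM i k) (HN k j))) _ _ _ =>
  [|k|k l];
  by rewrite !mxE // -!big_split.
Qed.

End PolynomialFunctions.

Arguments polyfun {R n}.

(** * The 2-jet of an invariant metric *)

Section ExponentialCoordinates.
Variables (R : realType) (n : nat).
Variable mu : 'cV[R]_n -> 'cV[R]_n -> 'cV[R]_n.
Hypothesis mu_linl : forall y, linear (mu ^~ y).
Hypothesis mu_linr : forall x, linear (mu x).

(* The matrix of the derivative at x of the left translation by - x. *)
Definition translation_mx (x : 'cV[R]_n) : 'M[R]_n :=
  \sum_(d < n) bch_coef R d.+1 *: ad_mx mu x ^+ d.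

Let ad k : 'M[R]_n := ad_mx mu (delta_mx k 0).

Lemma ad_mxE x i j : ad_mx mu x i j = \sum_k x k 0 * ad k i j.
Proof.
rewrite [in LHS](cV_sum_delta x) mxE bracket_suml // summxE.
by apply: eq_bigr => k _; rewrite bracketZl // !mxE.
Qed.

Lemma mxjet2_ad : mxjet2 (ad_mx mu) 0 ad (fun _ _ => 0).
Proof.
move=> i j; have -> : (fun x => ad_mx mu x i j) = fun x =>
  \sum_k x k 0 * ad k i j.
  by apply/funext => x; rewrite ad_mxE.
apply: jet2_eq (jet2_sum _
  (fun k => jet2M (jet2_coord R k) (jet2_cst n (ad k i j)))) _ _ _ => [|k|k l].
- by rewrite mxE big1 // => k _; rewrite mul0r.
- rewrite (bigD1 k) //= eqxx mul1r mul0r addr0 big1 ?addr0 // => l /negPf ->.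
  by rewrite !mul0r addr0.
by rewrite mxE big1 // => m _; rewrite !(mul0r, mulr0) !addr0.
Qed.

Lemma polyfun_ad_pow d i j : polyfun (fun x => (ad_mx mu x ^+ d) i j).
Proof.
have cM := @ring_closed_mulmx R _ polyfun (@polyfun_cst R n) (@polyfunD R n)
  (@polyfunM R n).
elim: d i j => [|d IHd] i j; first exact: polyfun_cst.
have -> : (fun x => (ad_mx mu x ^+ d.+1) i j) = fun x =>
  (ad_mx mu x *m ad_mx mu x ^+ d) i j.
  by apply/funext => x; rewrite exprS.
apply: cM => // k l.
by have [] := mxjet2_ad k l.
Qed.

Lemma polyfun_ad_series (m : nat) (c : 'I_m -> R) i j :
  polyfun (fun x => (\sum_(d < m) c d *: ad_mx mu x ^+ d) i j).
Proof.
have -> : (fun x => (\sum_(d < m) c d *: ad_mx mu x ^+ d) i j) =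
    fun x => \sum_(d < m) c d * (ad_mx mu x ^+ d) i j.
  by apply/funext => x; rewrite summxE; apply: eq_bigr => d _; rewrite mxE.
apply: (@ring_closed_sum _ _ polyfun (@polyfun_cst R n) (@polyfunD R n)) => d _.
by apply: polyfunM; [exact: polyfun_cst | exact: polyfun_ad_pow].
Qed.

Hypothesis ad_nil : forall x, ad_mx mu x ^+ n = 0.

(** The last term carries a factor $\operatorname{ad}_x^3$, and $\operatorname{ad}_x$ is linear in
    $x$, so it does not affect the 2-jet at $0$. *)
Lemma translation_mxE x : translation_mx x =
  1%:M + (- 2^-1) *: ad_mx mu x + 6^-1 *: (ad_mx mu x *m ad_mx mu x) +
  (ad_mx mu x *m ad_mx mu x) *m ad_mx mu x *m
    \sum_(d < n) bch_coef R d.+4 *: ad_mx mu x ^+ d.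
Proof.
(* Three vanishing terms pad the sum, so that three can be split off in front even when $n < 3$. *)
transitivity (\sum_(d < n.+3) bch_coef R d.+1 *: ad_mx mu x ^+ d).
  rewrite 3!big_ord_recr /=.
  have E m : ad_mx mu x ^+ (m + n) = 0 by rewrite exprD ad_nil mulr0.
  by rewrite (E 0%N) (E 1%N) (E 2%N) !scaler0 !addr0.
rewrite 3!big_ord_recl /= bch_coef1 bch_coef2 bch_coef3 expr0 scale1r expr1
  expr2.
rewrite -!addrA; do 3!congr (_ + _).
rewrite mulmx_sumr; apply: eq_bigr => d _.
by rewrite -scalemxAr !exprS -![_ * _]/(_ *m _) !mulmxA.
Qed.
Lemma mxjet2_translation :
  mxjet2 translation_mx 1%:M (fun k => (- 2^-1) *: ad k)
  (fun k l => 6^-1 *: (ad k *m ad l + ad l *m ad k)).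
Proof.
have -> : translation_mx = _ := funext translation_mxE.
have ad2 := mxjet2M mxjet2_ad mxjet2_ad.
have [|S0 [S1 [S2 HS]]] := @mxjet2_polyfun R n n n
    (fun x => \sum_(d < n) bch_coef R d.+4 *: ad_mx mu x ^+ d).
  exact: polyfun_ad_series.
have := mxjet2D (mxjet2D (mxjet2D (mxjet2_cst n 1%:M)
  (mxjet2Z (- 2^-1) mxjet2_ad)) (mxjet2Z 6^-1 ad2))
  (mxjet2M (mxjet2M ad2 mxjet2_ad) HS).
move/mxjet2_eq; apply => [|k|k l];
  by rewrite !(mul0mx, mulmx0, scaler0, addr0, add0r).
Qed.

Lemma mxjet2_metric (G : 'M[R]_n) :
  mxjet2 (fun x => (translation_mx x)^T *m G *m translation_mx x) G
    (fun k => (- 2^-1) *: ((ad k)^T *m G + G *m ad k))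
    (fun k l =>
      6^-1 *: ((ad k *m ad l + ad l *m ad k)^T *m G + G
        *m (ad k *m ad l + ad l *m ad k))
      + 4^-1 *: ((ad k)^T *m G *m ad l + (ad l)^T *m G *m ad k)).
Proof.
have H := mxjet2_translation.
apply: mxjet2_eq (mxjet2M (mxjet2M (mxjet2T H) (mxjet2_cst n G)) H) _ _ _ =>
  [|k|k l].
- by rewrite trmx1 mul1mx mulmx1.
- rewrite !(trmx1, mul1mx, mulmx1, mulmx0, addr0) [_^T]linearZ /= -scalemxAl
  -scalemxAr.
  by rewrite -scalerDr.
rewrite !(trmx1, mul1mx, mulmx1, mulmx0, addr0).
rewrite ![(_ *: _)^T]linearZ /= -!scalemxAl -!scalemxAr.
have E : - 2^-1 * - 2^-1 = 4^-1 :> R by field.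
rewrite !scalerA E !scalerDr -!addrA; congr (_ + _).
by rewrite addrA addrC.
Qed.

End ExponentialCoordinates.

(** * The Ricci tensor at the origin *)

Section RicciAtOrigin.
Variables (R : realType) (n : nat).

Section Jet.
Variables (g : tensor R n) (G : 'M[R]_n) (B : 'I_n -> 'M[R]_n).
Variable C : 'I_n -> 'I_n -> 'M[R]_n.
Hypothesis gjet : mxjet2 g G B C.
Hypothesis g_unit : forall x, g x \in unitmx.
Let W := invmx G.

(** Twice the Christoffel symbol of the first kind at $0$, where [B i j l] is $\partial_i
    g_{jl}$. *)
Definition christoffel_lower (l i j : 'I_n) : R := B i j l + B j i l - B l i j.

Lemma metric_at0 : g 0 = G.
Proof. by apply/matrixP => i j; have [] := gjet i j. Qed.

Lemma christoffel_at0 k i j :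
  christoffel g k i j 0 = 2^-1 * \sum_l W k l * christoffel_lower l i j.
Proof.
rewrite /christoffel metric_at0; congr (_ * _); apply: eq_bigr => l _.
have [_ _ e1 _] := gjet j l; have [_ _ e2 _] := gjet i l.
by have [_ _ e3 _] := gjet i j; rewrite e1 e2 e3.
Qed.

Lemma partial_christoffel_at0 m k i j : partial m (christoffel g k i j) 0 =
  2^-1 * \sum_l (W k l * (C m i j l + C m j i l - C m l i j)
                 - (W *m B m *m W) k l * christoffel_lower l i j).
Proof.
set v : 'cV[R]_n := delta_mx m 0.
have Hg : is_derive 0 v g (B m).
  apply/is_derive_mxP => a b; have [pg _ g1 _] := gjet a b.
  by rewrite -g1; apply/derivableP/polyfun_derivable.
have HW : is_derive 0 v (fun x => invmx (g x)) (- (W *m B m *m W)).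
  have -> : W = invmx (g 0) by rewrite metric_at0.
  exact: is_derive_invmx (nearW _ g_unit) Hg.
have Hp a b c : is_derive 0 v (partial a (fun y => g y b c)) (C m a b c).
  have [pg _ _ g2] := gjet b c.
  by rewrite -g2; apply/derivableP/polyfun_derivable/polyfun_partial.
have HL l : is_derive 0 v (fun x => partial i (fun y => g y j l) x
     + partial j (fun y => g y i l) x - partial l (fun y => g y i j) x)
    (C m i j l + C m j i l - C m l i j).
  exact: is_deriveB.
have H : is_derive 0 v (christoffel g k i j) (2^-1 *
    \sum_l (W k l * (C m i j l + C m j i l - C m l i j)
                 - (W *m B m *m W) k l * christoffel_lower l i j)).
  apply: is_deriveZ; apply: is_derive_sum_fun => l _.
  have := is_deriveM_fun ((is_derive_mxP _ _ _ _).1 HW k l) (HL l).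
  rewrite metric_at0 mxE.
  have [_ _ -> _] := gjet j l; have [_ _ -> _] := gjet i l.
  have [_ _ -> _] := gjet i j.
  by rewrite mulNr addrC.
by case: H.
Qed.

Lemma ricci_tensor_at0 j k : ricci_tensor g 0 j k =
  2^-1 * \sum_i \sum_l (W i l * (C i j k l + C i k j l - C i l j k)
                 - (W *m B i *m W) i l * christoffel_lower l j k)
  - 2^-1 * \sum_i \sum_l (W i l * (C j i k l + C j k i l - C j l i k)
                 - (W *m B j *m W) i l * christoffel_lower l i k)
  + \sum_i \sum_p (christoffel g p j k 0 * christoffel g i i p 0
                   - christoffel g p i k 0 * christoffel g i j p 0).
Proof.
rewrite mxE !mulr_sumr -sumrB -big_split /=; apply: eq_bigr => i _.
by rewrite /riemann !partial_christoffel_at0.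
Qed.

End Jet.

Section Invariant.
Variable mu : 'cV[R]_n -> 'cV[R]_n -> 'cV[R]_n.
Hypothesis mu_linl : forall y, linear (mu ^~ y).
Hypothesis mu_linr : forall x, linear (mu x).
Hypothesis mu_skew : forall x y, mu x y = - mu y x.
Hypothesis tr_ad : forall x, \tr (ad_mx mu x) = 0.
Hypothesis tr_ad_mul : forall x y, \tr (ad_mx mu x *m ad_mx mu y) = 0.
Variable G : 'M[R]_n.
Hypothesis G_sym : G^T = G.
Hypothesis G_unit : G \in unitmx.

Let W := invmx G.
Let e k : 'cV[R]_n := delta_mx k 0.
Let ad k : 'M[R]_n := ad_mx mu (e k).
Let B k := (- 2^-1) *: ((ad k)^T *m G + G *m ad k).
Let C k l := 6^-1 *: ((ad k *m ad l + ad l *m ad k)^T *m G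
                    + G *m (ad k *m ad l + ad l *m ad k))
             + 4^-1 *: ((ad k)^T *m G *m ad l + (ad l)^T *m G *m ad k).

(* The form (u, v) |-> (e_j, [u, v]). *)
Definition bracket_form (j : 'I_n) : 'M[R]_n := \matrix_(u, v) (G *m ad u) j v.
Let K := bracket_form.

Let WT : W^T = W. Proof. by rewrite /W trmx_inv G_sym. Qed.
Let Wsym i l : W i l = W l i. Proof. by rewrite -[in LHS]WT mxE. Qed.
Let WG : W *m G = 1%:M. Proof. exact: mulVmx. Qed.
Let GW : G *m W = 1%:M. Proof. exact: mulmxV. Qed.

Let ad_swap i l : ad i *m e l = - (ad l *m e i).
Proof. by rewrite !mul_ad_mx // mu_skew. Qed.

Let contract_skew (F : 'I_n -> 'I_n -> R) : (forall i l, F i l = - F l i) ->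
  \sum_i \sum_l W i l * F i l = 0.
Proof.
move=> Fskew; set s := LHS.
suff : s = - s by move/eqP; rewrite -addr_eq0 -mulr2n mulrn_eq0 => /eqP.
rewrite {1}/s exchange_big /= -sumrN; apply: eq_bigr => i _.
by rewrite -sumrN; apply: eq_bigr => l _; rewrite Wsym Fskew mulrN.
Qed.

Let contract_mx (M : 'M[R]_n) : \sum_i \sum_l W i l * M i l = \tr (M *m W).
Proof.
apply: eq_bigr => i _; rewrite mxE; apply: eq_bigr => l _.
by rewrite Wsym mulrC.
Qed.

(** For an orthonormal basis $(f_a)$, [t j k] is $\sum_a (e_j, [f_a, [e_k, f_a]])$ and [N j k] is
    $\sum_a ([e_j, f_a], [e_k, f_a])$. All surviving contractions of the 2-jet are expressed by
    these two. *)
Let t j k := \tr (K j *m ad k *m W).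
Let N j k := \tr ((ad j)^T *m G *m ad k *m W).

Let mulmx_entry_skew (m : nat) (M : 'M[R]_(m, n)) k i l :
  (M *m ad i) k l = - (M *m ad l) k i.
Proof.
have colE' (A : 'M[R]_(m, n)) j : A k j = (A *m e j) k 0 by rewrite -colE mxE.
by rewrite 2!colE' -!mulmxA ad_swap mulmxN mxE.
Qed.

Let N_sym j k : N j k = N k j.
Proof.
rewrite /N -mxtrace_tr !trmx_mul trmxK G_sym WT mulmxA mxtrace_mulC.
by rewrite mulmxA mxtrace_mulC !mulmxA.
Qed.

Let KE k i l : K k i l = (G *m ad i) k l. Proof. by rewrite mxE. Qed.

Let K_skew k : (K k)^T = - K k.
Proof. by apply/matrixP => i l;
  rewrite mxE [in RHS]mxE !KE mulmx_entry_skew. Qed.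
Let contract_mxT (M : 'M[R]_n) : \sum_i \sum_l W i l * M l i = \tr (M *m W).
Proof.
rewrite -contract_mx exchange_big; apply: eq_bigr => i _; apply: eq_bigr => l _.
by rewrite Wsym.
Qed.

Let KadE k j i l : (K k *m ad j) i l = (G *m (ad i *m ad j)) k l.
Proof.
by rewrite mulmxA [LHS]mxE [RHS]mxE; apply: eq_bigr => v _; rewrite KE.
Qed.

Let contract2 (F F' : 'I_n -> 'I_n -> R) :
  \sum_i \sum_l W i l * (F i l + F' i l) =
  \sum_i \sum_l W i l * F i l + \sum_i \sum_l W i l * F' i l.
Proof.
rewrite -big_split; apply: eq_bigr => i _; rewrite -big_split.
by apply: eq_bigr => l _; rewrite mulrDr.
Qed.

Let contractZ c (F : 'I_n -> 'I_n -> R) :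
  \sum_i \sum_l W i l * (c * F i l) = c * \sum_i \sum_l W i l * F i l.
Proof.
rewrite mulr_sumr; apply: eq_bigr => i _; rewrite mulr_sumr.
by apply: eq_bigr => l _; rewrite mulrCA.
Qed.

Let addE (M M' : 'M[R]_n) i l : (M + M') i l = M i l + M' i l.
Proof. by rewrite mxE. Qed.

Let oppE (M : 'M[R]_n) i l : (- M) i l = - M i l.
Proof. by rewrite mxE. Qed.

Let trE (M : 'M[R]_n) i l : M^T i l = M l i.
Proof. by rewrite mxE. Qed.

Let scaleE c (M : 'M[R]_n) i l : (c *: M) i l = c * M i l.
Proof. by rewrite mxE. Qed.

Let CE i j k l : C i j k l =
  6^-1 * (((G *m (ad i *m ad j)) l k + (G *m (ad j *m ad i)) l k)
          + ((G *m (ad i *m ad j)) k l + (G *m (ad j *m ad i)) k l))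
  + 4^-1 * (((ad i)^T *m G *m ad j) k l + ((ad j)^T *m G *m ad i) k l).
Proof.
rewrite /C !(addE, scaleE).
congr (_ * (_ + _) + _); last by rewrite mulmxDr addE.
have -> : (ad i *m ad j + ad j *m ad i)^T *m G =
  (G *m (ad i *m ad j + ad j *m ad i))^T.
  by rewrite trmx_mul G_sym.
by rewrite mxE mulmxDr addE.
Qed.
Let ad_ad_swap i j k : ad i *m (ad j *m e k) =
  - (ad_mx mu (ad j *m e k) *m e i).
Proof. by rewrite !mul_ad_mx // mu_skew. Qed.

Let GadadE i j l k :
  (G *m (ad i *m ad j)) l k = - (G *m ad_mx mu (ad j *m e k)) l i.
Proof.
have colE' (A : 'M[R]_n) a b : A a b = (A *m e b) a 0 by rewrite -colE mxE.
by rewrite 2!colE' -!mulmxA ad_ad_swap mulmxN mxE.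
Qed.
Let adGad_swapl i j k l : ((ad i)^T *m G *m ad j) k l =
  - ((ad k)^T *m G *m ad j) i l.
Proof.
have E a b : ((ad a)^T *m G *m ad j) b l = (((ad j)^T *m G) *m ad a) l b.
  have -> : ((ad j)^T *m G) *m ad a = ((ad a)^T *m G *m ad j)^T.
    by rewrite !trmx_mul trmxK G_sym mulmxA.
  by rewrite [RHS]mxE.
by rewrite !E mulmx_entry_skew.
Qed.

(** Of the six terms in [CE], one contracts to the trace of an adjoint map, one to the Killing form,
    and two are skew in the contracted indices; the other two give [t] and [N]. *)
Let contract_C1 j k : \sum_i \sum_l W i l * C i j k l =
  6^-1 * t k j - 4^-1 * N j k.
Proof.
under eq_bigr do under eq_bigr do rewrite CE.
rewrite contract2 !contractZ !contract2.
have -> : \sum_i \sum_l W i l * (G *m (ad i *m ad j)) l k = 0.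
  under eq_bigr do under eq_bigr do rewrite GadadE -oppE.
  by rewrite contract_mxT mulNmx linearN /= mxtrace_mulC mulmxA WG mul1mx tr_ad
    oppr0.
have -> : \sum_i \sum_l W i l * (G *m (ad j *m ad i)) l k = 0.
  under eq_bigr do under eq_bigr do rewrite mulmxA mulmx_entry_skew -oppE.
  rewrite contract_mxT mulNmx linearN /= mxtrace_mulC !mulmxA WG mul1mx.
  by rewrite tr_ad_mul oppr0.
have -> : \sum_i \sum_l W i l * (G *m (ad i *m ad j)) k l = t k j.
  by under eq_bigr do under eq_bigr do rewrite -KadE; rewrite contract_mx.
rewrite [X in _ * (_ + (_ + X))]contract_skew; last first.
  by move=> i l; rewrite !mulmxA mulmx_entry_skew.
rewrite [X in _ + _ * (_ + X)]contract_skew; last first.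
  by move=> i l; rewrite mulmx_entry_skew.
have -> : \sum_i \sum_l W i l * ((ad i)^T *m G *m ad j) k l = - N j k.
  under eq_bigr do under eq_bigr do rewrite adGad_swapl -oppE.
  by rewrite contract_mx mulNmx linearN N_sym.
by rewrite !addr0 !add0r mulrN.
Qed.

Let contract_C2 j k : \sum_i \sum_l W i l * C i l j k =
  - (3^-1 * (t j k + t k j)) + 2^-1 * N j k.
Proof.
have E a b : \sum_i \sum_l W i l * (G *m (ad i *m ad l)) a b = - t a b.
  have adadE i l : (G *m (ad i *m ad l)) a b = (- (K a *m ad b)) i l.
    by rewrite oppE mulmxA mulmx_entry_skew -mulmxA -KadE.
  under eq_bigr do under eq_bigr do rewrite adadE.
  by rewrite contract_mx mulNmx linearN.
have ET (F : 'I_n -> 'I_n -> R) :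
    \sum_i \sum_l W i l * F l i = \sum_i \sum_l W i l * F i l.
  rewrite exchange_big; apply: eq_bigr => i _; apply: eq_bigr => l _.
  by rewrite Wsym.
have EN : \sum_i \sum_l W i l * ((ad i)^T *m G *m ad l) j k = N j k.
  have H i l : ((ad i)^T *m G *m ad l) j k = ((ad j)^T *m G *m ad k) i l.
    by rewrite adGad_swapl mulmx_entry_skew opprK.
  by under eq_bigr do under eq_bigr do rewrite H; rewrite contract_mx.
under eq_bigr do under eq_bigr do rewrite CE.
rewrite contract2 !contractZ !contract2.
rewrite (ET (fun i l => (G *m (ad i *m ad l)) k j))
  (ET (fun i l => (G *m (ad i *m ad l)) j k)).
rewrite (ET (fun i l => ((ad i)^T *m G *m ad l) j k)) !E EN.
by field.
Qed.

Let BE i k l : B i k l = - 2^-1 * ((G *m ad i) l k + (G *m ad i) k l).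
Proof.
rewrite /B scaleE addE; congr (_ * (_ + _)).
by have -> : (ad i)^T *m G = (G *m ad i)^T; rewrite ?mxE // trmx_mul G_sym.
Qed.

Let lowerE l i k :
  christoffel_lower B l i k = - ((G *m ad i) k l + (G *m ad k) i l).
Proof.
rewrite /christoffel_lower !BE (mulmx_entry_skew _ _ k i)
  (mulmx_entry_skew _ _ l k).
by rewrite (mulmx_entry_skew _ _ l i); field.
Qed.

(** The entry [(p, i)] is the Christoffel symbol $\Gamma^p_{ik}$ at the origin. *)
Let gamma k : 'M[R]_n := 2^-1 *: (W *m (K k - (ad k)^T *m G)).
Let gammaE p i k : 2^-1 * (\sum_l W p l * christoffel_lower B l i k) =
  gamma k p i.
Proof.
rewrite scaleE [in RHS]mxE; congr (_ * _); apply: eq_bigr => l _.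
congr (_ * _); rewrite lowerE addE oppE KE (mulmx_entry_skew _ k l i).
have -> : (ad k)^T *m G = (G *m ad k)^T by rewrite trmx_mul G_sym.
by rewrite trE opprD.
Qed.

Let tr_B k : \tr (B k *m W) = 0.
Proof.
rewrite /B -scalemxAl linearZ /= mulmxDl linearD /= -mulmxA GW mulmx1
  mxtrace_tr.
by rewrite mxtrace_mulC mulmxA WG mul1mx tr_ad addr0 mulr0.
Qed.

Let B_sym k i l : B k i l = B k l i.
Proof. by rewrite !BE addrC. Qed.

Let C_sym a b i l : C a b i l = C a b l i.
Proof.
rewrite !CE; congr (_ * _ + _ * _); first by rewrite addrC.
have E c d : ((ad c)^T *m G *m ad d) i l = ((ad d)^T *m G *m ad c) l i.
  have -> : (ad d)^T *m G *m ad c = ((ad c)^T *m G *m ad d)^T.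
    by rewrite !trmx_mul trmxK G_sym mulmxA.
  by rewrite [RHS]mxE.
by rewrite !(E _ _) addrC.
Qed.

(** $\Gamma^i_{ip}$ is half the derivative of $\log\det g$, which vanishes at $0$ by
    unimodularity. *)
Let tr_gamma p : \tr (gamma p) = 0.
Proof.
rewrite /mxtrace.
under eq_bigr do rewrite -gammaE.
rewrite -mulr_sumr.
have H i l : W i l * christoffel_lower B l i p =
  W i l * (B p i l + (B i p l - B l i p)).
  by rewrite /christoffel_lower; congr (_ * _);
    rewrite addrA [_ + B p i l]addrC (addrC (B p i l)).
under eq_bigr do under eq_bigr do rewrite H.
rewrite contract2 contract_mx tr_B add0r.
by rewrite contract_skew ?mulr0 // => i l; rewrite (B_sym i) (B_sym l) opprB.
Qed.

Let trB (M M' : 'M[R]_n) : \tr (M - M') = \tr M - \tr M'.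
Proof. exact: linearB. Qed.

Let tr_gamma2 j k : \tr (gamma k *m gamma j) =
  4^-1 * (\tr (W *m K j *m W *m K k) + t j k + t k j).
Proof.
have E4 : \tr (W *m ((ad k)^T *m G) *m (W *m ((ad j)^T *m G))) = 0.
  rewrite !mulmxA mxtrace_mulC !mulmxA GW mul1mx -[_ *m G *m W]mulmxA GW mulmx1.
  by rewrite -trmx_mul mxtrace_tr tr_ad_mul.
have E2 a b : \tr (W *m K a *m (W *m ((ad b)^T *m G))) = - t a b.
  rewrite !mulmxA mxtrace_mulC !mulmxA GW mul1mx -mxtrace_tr !trmx_mul trmxK WT.
  by rewrite K_skew !mulmxN linearN /= mulmxA mxtrace_mulC mulmxA.
have E3 : \tr (W *m ((ad k)^T *m G) *m (W *m K j)) = - t j k.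
  by rewrite mxtrace_mulC E2.
rewrite /gamma -scalemxAl -scalemxAr scalerA linearZ /= !mulmxBr !mulmxBl.
have E1 : \tr (W *m K k *m (W *m K j)) = \tr (W *m K j *m W *m K k).
  by rewrite mxtrace_mulC mulmxA.
rewrite trB trB trB E1 E2 E3 E4.
by move: (t j k) (t k j) => t1 t2; field.
Qed.

Let W_B_W i : W *m B i *m W = - 2^-1 *: (W *m (ad i)^T + ad i *m W).
Proof.
rewrite /B -scalemxAr -scalemxAl; congr (_ *: _).
rewrite mulmxDr mulmxDl !mulmxA WG mul1mx; congr (_ + _).
by rewrite -[_ *m G *m W]mulmxA GW mulmx1.
Qed.

(** Up to sign this is the divergence $\partial_i g^{il}$ at $0$. One half contracts a skew
    expression with [W]; the other contains the trace of an adjoint map. *)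
Let div_inverse l : \sum_i (W *m B i *m W) i l = 0.
Proof.
have E i : (W *m B i *m W) i l =
  - 2^-1 * ((W *m (ad i)^T) i l + (ad i *m W) i l).
  by rewrite W_B_W scaleE addE.
under eq_bigr do rewrite E.
have ad_entry a b c : ad a c b = - ad b c a.
  by have := mulmx_entry_skew 1%:M c a b; rewrite !mul1mx.
rewrite -mulr_sumr big_split /= [X in X + _](_ : _ = 0); last first.
  rewrite -[RHS](@contract_skew (fun i p => ad i l p)) => [|i p];
    last exact: ad_entry.
  by apply: eq_bigr => i _; rewrite mxE; apply: eq_bigr => p _; rewrite trE.
rewrite [X in _ + X](_ : _ = 0) ?addr0 ?mulr0 //.
under eq_bigr do rewrite mxE.
rewrite exchange_big big1 //= => p _; rewrite -mulr_suml.
under eq_bigr do rewrite ad_entry.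
by have := tr_ad (e p); rewrite sumrN /mxtrace => ->; rewrite oppr0 mul0r.
Qed.

Let tr_C j k : \tr (C j k *m W) = 2^-1 * N j k.
Proof.
rewrite /C mulmxDl mxtraceD -!scalemxAl !mxtraceZ !mulmxDl !mxtraceD.
rewrite -/(N j k) -/(N k j) (N_sym k j).
have -> M : \tr (M *m G *m W) = \tr M by rewrite -mulmxA GW mulmx1.
have H a b : \tr (G *m (ad a *m ad b) *m W) = 0.
  by rewrite mxtrace_mulC !mulmxA WG mul1mx tr_ad_mul.
rewrite mxtrace_tr mxtraceD !tr_ad_mul mulmxDr mulmxDl mxtraceD !H !addr0 mulr0
  add0r.
by move: (N j k) => t1; field.
Qed.

Let tr_BB j k : \sum_i \sum_l (W *m B j *m W) i l * B k i l = 2^-1 * N j k.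
Proof.
transitivity (\tr (W *m B j *m W *m B k)).
  apply: eq_bigr => i _; rewrite mxE; apply: eq_bigr => l _.
  by rewrite (B_sym _ l).
rewrite W_B_W /B -scalemxAl -scalemxAr scalerA linearZ /= mulmxDl !mulmxDr
  !mxtraceD.
have E1 : \tr (W *m (ad j)^T *m ((ad k)^T *m G)) = 0.
  rewrite !mulmxA mxtrace_mulC !mulmxA GW mul1mx -trmx_mul mxtrace_tr.
  exact: tr_ad_mul.
have E2 : \tr (W *m (ad j)^T *m (G *m ad k)) = N j k.
  by rewrite -mulmxA mxtrace_mulC !mulmxA.
have E3 : \tr (ad j *m W *m ((ad k)^T *m G)) = N j k.
  by rewrite mxtrace_mulC !mulmxA -/(N k j) N_sym.
have E4 : \tr (ad j *m W *m (G *m ad k)) = 0.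
  by rewrite !mulmxA -[_ *m W *m G]mulmxA WG mulmx1 tr_ad_mul.
rewrite E1 E2 E3 E4; move: (N j k) => t1; by field.
Qed.

(* Since tr ad_x = 0 and tr (ad_x ad_y) = 0, the only other contractions are  *)
(* the t's; those coming from the second derivatives of the metric cancel     *)
(* those coming from the product of the Christoffel symbols.                  *)
Lemma ricci_invariant (g : tensor R n) j k :
  mxjet2 g G B C -> (forall x, g x \in unitmx) ->
  ricci_tensor g 0 j k = - 2^-1 * N j k - 4^-1 * \tr (W *m K j *m W *m K k).
Proof.
move=> gjet gu; rewrite (ricci_tensor_at0 gjet gu).
have -> : \sum_i \sum_p (christoffel g p j k 0 * christoffel g i i p 0
     - christoffel g p i k 0 * christoffel g i j p 0) =
       - \tr (gamma k *m gamma j).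
  have Gsym i p : christoffel g i j p 0 = gamma j i p.
    rewrite (christoffel_at0 gjet) -gammaE; congr (_ * _);
      apply: eq_bigr => l _.
    by rewrite /christoffel_lower (B_sym l) [B j p l + _]addrC.
  under eq_bigr do rewrite sumrB.
  rewrite sumrB exchange_big /= [X in X - _]big1 ?sub0r => [|p _].
    congr (- _); rewrite exchange_big /mxtrace /=; apply: eq_bigr => p _.
    rewrite mxE; apply: eq_bigr => i _.
    by rewrite Gsym (christoffel_at0 gjet) gammaE.
  rewrite -mulr_sumr; suff -> : \sum_i christoffel g i i p 0 = \tr (gamma p).
    by rewrite tr_gamma mulr0.
  by apply: eq_bigr => i _; rewrite (christoffel_at0 gjet) gammaE.
(* This is $2\,\partial_i\Gamma^i_{jk}$; the derivative of the inverse metric drops out by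
   [div_inverse]. *)
have -> : \sum_i \sum_l (W i l * (C i j k l + C i k j l - C i l j k)
    - (W *m B i *m W) i l * christoffel_lower B l j k) =
    2^-1 * (t j k + t k j) - N j k.
  have E i l : W i l * (C i j k l + C i k j l - C i l j k)
      - (W *m B i *m W) i l * christoffel_lower B l j k
    = W i l * (C i j k l + (C i k j l + (- 1) * C i l j k))
      - (W *m B i *m W) i l * christoffel_lower B l j k.
    by rewrite mulN1r addrA.
  under eq_bigr do under eq_bigr do rewrite E.
  under eq_bigr do rewrite sumrB.
  rewrite sumrB [X in _ - X]exchange_big /= [X in _ - X]big1 => [|l _];
    last first.
    by rewrite -mulr_suml div_inverse mul0r.
  rewrite subr0 2!contract2 (contractZ (- 1) (fun i l => C i l j k)).
  rewrite (contract_C1 j k) (contract_C1 k j) (contract_C2 j k) (N_sym k j).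
  move: (t j k) (t k j) (N j k) => t1 t2 t3; by field.
(* This is $2\,\partial_j\Gamma^i_{ik} = \partial_j\partial_k\log\det g$: the contributions [tr_C]
   and [tr_BB] cancel, and the rest is skew in the contracted indices. *)
have -> : \sum_i \sum_l (W i l * (C j i k l + C j k i l - C j l i k)
    - (W *m B j *m W) i l * christoffel_lower B l i k) = 0.
  have E i l : W i l * (C j i k l + C j k i l - C j l i k)
      - (W *m B j *m W) i l * christoffel_lower B l i k
    = W i l * (C j k i l + (C j i k l - C j l i k))
      - ((W *m B j *m W) i l * B k i l + (W *m B j *m W) i l
        * (B i k l - B l i k)).
    by rewrite /christoffel_lower; ring.
  under eq_bigr do under eq_bigr do rewrite E.
  under eq_bigr do rewrite sumrB big_split /=.
  rewrite sumrB big_split /= contract2 contract_mx tr_C tr_BB.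
  rewrite contract_skew => [|i l];
    last by rewrite (C_sym j i) (C_sym j l) opprB.
  set s := (X in _ - (_ + X)).
  suff -> : s = 0 by rewrite !addr0 subrr.
  have : s = - s.
    rewrite {1}/s exchange_big /= -sumrN; apply: eq_bigr => i _; rewrite -sumrN.
    apply: eq_bigr => l _; rewrite -mulrN opprB (B_sym l) (B_sym i);
      congr (_ * _).
    have H : (W *m B j *m W)^T = W *m B j *m W.
      rewrite !trmx_mul WT mulmxA; congr (_ *m _ *m _).
      by apply/matrixP => a b; rewrite trE B_sym.
    by rewrite -[in LHS]H trE.
  by move/eqP; rewrite -addr_eq0 -mulr2n mulrn_eq0 => /eqP.
rewrite tr_gamma2.
by field.
Qed.

End Invariant.
End RicciAtOrigin.

(** * The Ricci tensor in an orthonormal frame *)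

Section OrthonormalFrame.
Variables (R : realType) (n : nat).
Variable mu : 'cV[R]_n -> 'cV[R]_n -> 'cV[R]_n.
Hypothesis mu_linl : forall y, linear (mu ^~ y).
Hypothesis mu_linr : forall x, linear (mu x).
Hypothesis mu_skew : forall x y, mu x y = - mu y x.

(* The structure constants of mu in the basis of the columns of invmx L; this *)
(* basis is orthonormal for the inner product L^T *m L.                       *)
Definition frame_coef (L : 'M[R]_n) (a b d : 'I_n) : R :=
  (L *m mu (col a (invmx L)) (col b (invmx L))) d 0.

Lemma frame_coef_skew L a b d : frame_coef L a b d = - frame_coef L b a d.
Proof. by rewrite /frame_coef mu_skew mulmxN mxE. Qed.

Hypothesis tr_ad : forall x, \tr (ad_mx mu x) = 0.
Hypothesis tr_ad_mul : forall x y, \tr (ad_mx mu x *m ad_mx mu y) = 0.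

(** For $Q = L^{-1}$ the inverse metric is $Q Q^T$, so each contraction with it becomes a plain sum
    over the frame. Skewness of the bracket turns the negative trace term of [ricci_invariant] into
    a positive sum. *)
Lemma ricci_frame (g : tensor R n) (L : 'M[R]_n) :
  L \in unitmx ->
  (forall x, g x \in unitmx) ->
  mxjet2 g (L^T *m L)
    (fun k => (- 2^-1) *: ((ad_mx mu (delta_mx k 0))^T *m (L^T *m L) +
                           (L^T *m L) *m ad_mx mu (delta_mx k 0)))
    (fun k l =>
      let ad k := ad_mx mu (delta_mx k 0) in let G := L^T *m L in
      6^-1 *: ((ad k *m ad l + ad l *m ad k)^T *m G + G
        *m (ad k *m ad l + ad l *m ad k))
      + 4^-1 *: ((ad k)^T *m G *m ad l + (ad l)^T *m G *m ad k)) ->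
  forall d e, ((invmx L)^T *m ricci_tensor g 0 *m invmx L) d e =
    - 2^-1 * (\sum_a \sum_b frame_coef L d a b * frame_coef L e a b)
    + 4^-1 * (\sum_a \sum_b frame_coef L a b d * frame_coef L a b e).
Proof.
move=> Lu gu gjet d e.
set c := frame_coef L; set G := L^T *m L; set Q := invmx L.
have GT : G^T = G by rewrite trmx_mul trmxK.
have Gu : G \in unitmx by rewrite unitmx_mul unitmx_tr Lu.
have QL : Q *m L = 1%:M by rewrite mulVmx.
have LQ : L *m Q = 1%:M by rewrite mulmxV.
have WE : invmx G = Q *m Q^T.
  have GQ : G *m (Q *m Q^T) = 1%:M.
    by rewrite /G !mulmxA -(mulmxA _ L) LQ mulmx1 -trmx_mul QL trmx1.
  by rewrite -[LHS]mulmx1 -GQ mulmxA mulVmx // mul1mx.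
have trE (M : 'M[R]_n) i j : M^T i j = M j i by rewrite mxE.
pose ad k := ad_mx mu (delta_mx k 0).
have adQ a : ad_mx mu (col a Q) = \sum_j Q j a *: ad j.
  apply/matrixP => u v; rewrite ad_mxE // summxE; apply: eq_bigr => k _.
  by rewrite !mxE.
have cE a b f : c a b f = (L *m ad_mx mu (col a Q) *m Q) f b.
  have -> : (L *m ad_mx mu (col a Q) *m Q) f b =
    ((L *m ad_mx mu (col a Q) *m Q) *m delta_mx b 0 : 'cV_n) f 0.
    by rewrite -colE [RHS]mxE.
  by rewrite -!mulmxA -colE mul_ad_mx.
pose K := bracket_form mu G.
have KE a b f : c a b f = (Q^T *m (\sum_j Q j f *: K j) *m Q) a b.
  rewrite cE.
  have -> : L = Q^T *m G by rewrite /G mulmxA -trmx_mul LQ trmx1 mul1mx.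
  rewrite [LHS]mxE [RHS]mxE; apply: eq_bigr => v _; congr (_ * _).
  rewrite adQ mulmx_sumr summxE mxE; apply: eq_bigr => u _.
  rewrite -scalemxAr mxE trE; congr (_ * _).
  rewrite summxE -mulmxA mxE; apply: eq_bigr => j _.
  by rewrite trE [RHS]mxE; congr (_ * _); rewrite [RHS]mxE.
pose rc := fun j k => - 2^-1 * \tr ((ad j)^T *m G *m ad k *m invmx G)
   - 4^-1 * \tr (invmx G *m K j *m invmx G *m K k).
have rcE : (Q^T *m ricci_tensor g 0 *m Q) d e =
  \sum_j \sum_k Q j d * Q k e * rc j k.
  rewrite mxE exchange_big; apply: eq_bigr => k _; rewrite mxE mulr_suml.
  apply: eq_bigr => j _; rewrite mxE mulrAC; congr (_ * _).
  exact: (ricci_invariant mu_linr mu_skew tr_ad tr_ad_mul GT Gu).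
pose D f : 'M[R]_n := \sum_j Q j f *: ad j.
pose Kf f : 'M[R]_n := \sum_j Q j f *: K j.
have trD1 : \sum_j \sum_k Q j d * Q k e * \tr
  ((ad j)^T *m G *m ad k *m invmx G) =
    \tr ((D d)^T *m G *m D e *m invmx G).
  have -> : (D d)^T = \sum_j Q j d *: (ad j)^T.
    by rewrite /D [LHS]linear_sum; apply: eq_bigr => j _; rewrite linearZ.
  rewrite !mulmx_suml raddf_sum; apply: eq_bigr => j _ /=.
  rewrite mulmx_sumr mulmx_suml raddf_sum; apply: eq_bigr => k _ /=.
  by rewrite -!scalemxAl -scalemxAr -scalemxAl !mxtraceZ mulrA.
have trD2 : \sum_j \sum_k Q j d * Q k e * \tr
  (invmx G *m K j *m invmx G *m K k) =
    \tr (invmx G *m Kf d *m invmx G *m Kf e).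
  have H1 (M : 'M[R]_n) : \tr (invmx G *m Kf d *m M) =
      \sum_j Q j d * \tr (invmx G *m K j *m M).
    rewrite mulmx_sumr mulmx_suml raddf_sum; apply: eq_bigr => j _ /=.
    by rewrite -scalemxAr -scalemxAl mxtraceZ.
  have H2 (M : 'M[R]_n) : \tr (M *m Kf e) = \sum_k Q k e * \tr (M *m K k).
    rewrite mulmx_sumr raddf_sum; apply: eq_bigr => k _ /=.
    by rewrite -scalemxAr mxtraceZ.
  rewrite -(mulmxA _ (invmx G)) H1; apply: eq_bigr => j _.
  rewrite mulmxA H2 mulr_sumr; apply: eq_bigr => k _.
  by rewrite mulrA.
have rcE2 : (Q^T *m ricci_tensor g 0 *m Q) d e =
    - 2^-1 * \tr ((D d)^T *m G *m D e *m invmx G)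
   - 4^-1 * \tr (invmx G *m Kf d *m invmx G *m Kf e).
  rewrite rcE -trD1 -trD2 !mulr_sumr -sumrB; apply: eq_bigr => j _.
  rewrite !mulr_sumr -sumrB; apply: eq_bigr => k _.
  by rewrite /rc mulrBr; congr (_ - _); exact: mulrCA.
rewrite rcE2 WE; congr (_ + _).
  congr (_ * _).
  have -> : \tr ((D d)^T *m G *m D e *m (Q *m Q^T)) =
    \tr ((L *m D d *m Q)^T *m (L *m D e *m Q)).
    by rewrite /G !mulmxA mxtrace_mulC !trmx_mul !mulmxA.
  apply: eq_bigr => a _; rewrite mxE; apply: eq_bigr => b _.
  by rewrite trE !cE !adQ.
rewrite -mulrN; congr (_ * _).
have -> : \tr (Q *m Q^T *m Kf d *m (Q *m Q^T) *m Kf e) =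
  \tr ((Q^T *m Kf d *m Q) *m (Q^T *m Kf e *m Q)).
  by rewrite -!mulmxA mxtrace_mulC !mulmxA.
rewrite -sumrN; apply: eq_bigr => a _; rewrite mxE -sumrN;
  apply: eq_bigr => b _.
by rewrite -!KE [c b a e]frame_coef_skew mulrN opprK.
Qed.

End OrthonormalFrame.

(** * Factorization of an inner product *)

Section Cholesky.
Variable R : realType.

Lemma inner_product_unitmx n (G : 'M[R]_n) : inner_product G -> G \in unitmx.
Proof.
move=> [_ Gpos]; rewrite -row_free_unit -kermx_eq0; apply/eqP/row_matrixP => i.
rewrite row0; apply/eqP/negPn/negP => v0.
have vT0 : (row i (kermx G))^T != 0 by rewrite trmx_eq0.
by have := Gpos _ vT0; rewrite trmxK -row_mul mulmx_ker row0 mul0mx mxE ltxx.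
Qed.
(** Induction on the dimension: the Schur complement [S] of the first diagonal entry is again an
    inner product. *)
Lemma cholesky n (G : 'M[R]_n) : inner_product G -> exists P :
  'M[R]_n, P^T *m P = G.
Proof.
elim: n G => [|n IHn] G [GT Gpos]; first by exists 0;
  rewrite [RHS]flatmx0 [LHS]flatmx0.
pose G' : 'M[R]_(1 + n) := G.
have Gpos' (v : 'cV[R]_(1 + n)) : v != 0 ->
  0 < (v^T *m G' *m v) 0 0 by apply: Gpos.
pose a := ulsubmx G' 0 0; pose b : 'rV[R]_n := ursubmx G'; pose D := drsubmx G'.
have GE : G' = block_mx a%:M b b^T D.
  rewrite -[LHS]submxK; congr block_mx; first by rewrite [LHS]mx11_scalar.
  by rewrite trmx_ursub GT.
have DT : D^T = D by rewrite /D trmx_drsub GT.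
have form (x : 'cV[R]_1) (y : 'cV[R]_n) :
    (col_mx x y)^T *m G' *m col_mx x y =
    x^T *m a%:M *m x + (x^T *m b *m y)^T + x^T *m b *m y + y^T *m D *m y.
  rewrite GE tr_col_mx mul_row_block mul_row_col !mulmxDl !trmx_mul trmxK
    !mulmxA.
  by rewrite -!addrA; congr (_ + _); rewrite addrCA.
have a0 : 0 < a.
  have := Gpos' (col_mx (1%:M : 'cV_1) (0 : 'cV_n)).
  rewrite form !mulmx0 trmx0 !addr0 trmx1 mul1mx mulmx1 mxE mulr1n; apply.
  apply/negP; rewrite col_mx_eq0 => /andP[/eqP/matrixP/(_ 0 0)].
  by rewrite !mxE => /eqP; rewrite oner_eq0.
pose S := D - a^-1 *: (b^T *m b).
have [|P' P'E] := IHn S.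
  split; first by rewrite /S linearB linearZ /= DT trmx_mul trmxK.
  move=> v v0.
  (* For fixed [v] this first coordinate minimizes the form, and the minimum is the value of [S] at
     [v]. *)
  have := Gpos' (col_mx (- a^-1 *: (b *m v)) v).
  rewrite form /S => H; set q := (b *m v) 0 0.
  have bvE : b *m v = q%:M by rewrite [LHS]mx11_scalar.
  have vbE : v^T *m b^T = q%:M by rewrite -trmx_mul bvE tr_scalar_mx.
  have {H} : 0 < - a^-1 * q * a * (- a^-1 * q) + - a^-1 * q * q + - a^-1 * q * q
      + (v^T *m D *m v) 0 0.
    move: H; rewrite bvE scale_scalar_mx tr_scalar_mx -!scalar_mxM -mulmxA bvE.
    rewrite -!scalar_mxM tr_scalar_mx !mxE !eqxx !mulr1n; apply.
    by apply: contraNneq v0 => /eqP; rewrite col_mx_eq0 => /andP[_].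
  rewrite mulmxBr mulmxBl -scalemxAr -scalemxAl !mulmxA vbE
    -[q%:M *m b *m v]mulmxA bvE -scalar_mxM.
  rewrite !mxE !eqxx !mulr1n; congr (_ < _).
  by field; rewrite gt_eqF.
suff : exists P : 'M[R]_(1 + n), P^T *m P = G' by [].
exists (block_mx (Num.sqrt a)%:M ((Num.sqrt a)^-1 *: b) 0 P').
rewrite GE tr_block_mx mulmx_block P'E trmx0 !mulmx0 !mul0mx.
have s0 : Num.sqrt a != 0 by rewrite gt_eqF // sqrtr_gt0.
have ss : Num.sqrt a * Num.sqrt a = a by rewrite -expr2 sqr_sqrtr // ltW.
rewrite !addr0 tr_scalar_mx -scalar_mxM ss mul_scalar_mx scalerA divff //
  scale1r.
congr block_mx.
  by rewrite linearZ /= -scalemxAl mul_mx_scalar scalerA mulVf // scale1r.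
rewrite [(_ *: _)^T]linearZ /= -scalemxAl -scalemxAr scalerA -invfM ss /S.
by rewrite addrCA subrr addr0.
Qed.

End Cholesky.

(** * Curves on the closed half-line and a Riccati inequality *)

Section NonnegCurves.
Variable R : realType.

Lemma is_derivative_on_nonneg_cvg (V : normedModType R) (c : R -> V) t c' :
  is_derivative_on_nonneg c t c' ->
    c s @[s --> within [set s | 0 <= s] t^'] --> c t.
Proof.
move=> Hc; set F := within _ _ in Hc *.
have FF : Filter F by exact: within_filter.
have Ft : s @[s --> F] --> t.
  by apply: cvg_trans (cvg_within _) _; exact: cvg_within.
have H0 : (s - t) *: ((s - t)^-1 *: (c s - c t)) @[s --> F] --> (t - t) *: c'.
  by apply: cvgZ Hc; apply: cvgB => //; exact: cvg_cst.
have : c t + (s - t) *: ((s - t)^-1 *: (c s - c t)) @[s --> F] --> c t.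
  rewrite -[X in _ --> X]addr0 -(scale0r c') -(subrr t).
  by apply: cvgD H0; exact: cvg_cst.
apply: cvg_trans; apply: near_eq_cvg.
have : \forall s \near t^', s != t by exact: nbhs_dnbhs_neq.
apply: filterS => s st _.
by rewrite scalerA divff ?subr_eq0 // scale1r addrC subrK.
Qed.
Lemma is_derivative_on_nonneg_is_derive (V : normedModType R) (c : R -> V) t c'
  :
  0 < t -> is_derivative_on_nonneg c t c' -> is_derive t 1 c c'.
Proof.
move=> t0 Hc.
have Ht : h + t @[h --> (0 : R)] --> t.
  rewrite -[X in _ --> X]add0r; apply: cvgD; [exact: cvg_id | exact: cvg_cst].
have Hs : h + t @[h --> (0 : R)^'] --> within [set s | 0 <= s] t^'.
  move=> A; rewrite /nbhs /= /within /dnbhs /within /= => HA.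
  have H1 := Ht _ HA; have H2 := Ht _ (lt_nbhsr t0).
  near=> h => h0.
  have Ah : h + t != t -> 0 <= h + t -> A (h + t) by near: h; exact: H1.
  apply: Ah; first by rewrite -subr_eq0 addrK.
  by apply: ltW; near: h; exact: H2.
have Hq : h^-1 *: (c (h *: 1 + t) - c t) @[h --> 0^'] --> c'.
  have := cvg_comp _ _ Hs Hc; apply: cvg_trans.
  apply: near_eq_cvg; near=> h.
  by rewrite /= addrK [h *: 1]mulr1.
apply: DeriveDef; first by apply/cvg_ex; exists c'.
by apply: cvg_lim Hq.
Unshelve. all: by end_near. Qed.

Lemma is_derivative_on_nonneg_right (V : normedModType R) (c : R -> V) c' :
  is_derivative_on_nonneg c 0 c' -> c s @[s --> 0^'+] --> c 0.
Proof.
move=> /is_derivative_on_nonneg_cvg; apply: cvg_trans; apply: cvg_app.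
move=> A HA.
have {}HA : \forall s \near (0 : R), s != 0 -> 0 <= s -> A s by exact: HA.
change (\forall s \near (0 : R), 0 < s -> A s).
by apply: filterS HA => s H s0; apply: H; [rewrite gt_eqF | exact: ltW].
Qed.

Section Monotone.
Variables f f' : R -> R.
Hypothesis f_right : f s @[s --> 0^'+] --> f 0.
Hypothesis f_derive : forall t : R, 0 < t -> is_derive t 1 f (f' t).

Lemma nonneg_MVT t : 0 < t -> exists2 s, 0 < s < t & f t - f 0 = f' s * t.
Proof.
move=> t0.
have [||s] := @MVT R f f' 0 t t0.
- by move=> s; rewrite in_itv /= => /andP[s0 _]; apply: f_derive.
- apply/continuous_within_itvP => //; split => //.
    move=> s; rewrite in_itv /= => /andP[s0 _].
    apply: differentiable_continuous; apply/derivable1_diffP.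
    by case: (f_derive s0).
  apply: cvg_at_left_filter; apply: differentiable_continuous;
    apply/derivable1_diffP.
  by case: (f_derive t0).
by rewrite in_itv /= subr0 => st E; exists s.
Qed.

Lemma nonneg_derive0_cst : (forall t, 0 < t -> f' t = 0) ->
  forall t, 0 <= t -> f t = f 0.
Proof.
move=> f'0 t; rewrite le_eqVlt => /orP[/eqP <-//|t0].
have [s /andP[s0 _] /eqP] := nonneg_MVT t0.
by rewrite f'0 // mul0r subr_eq0 => /eqP.
Qed.

Lemma nonneg_nonincreasing : (forall t, 0 < t -> f' t <= 0) ->
  forall s t, 0 < s -> s <= t -> f t <= f s.
Proof.
move=> f'0 s t s0; rewrite le_eqVlt => /orP[/eqP <-//|st].
have [||x] := @MVT R f f' s t st.
- move=> x; rewrite in_itv /= => /andP[sx _]; apply: f_derive.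
  exact: lt_trans sx.
- apply: continuous_in_subspaceT => x; rewrite inE /= in_itv /= => /andP[sx _].
  apply: differentiable_continuous; apply/derivable1_diffP.
  by case: (f_derive (lt_le_trans s0 sx)).
rewrite in_itv /= => /andP[sx _] E; rewrite -subr_le0 E.
rewrite pmulr_lle0 ?subr_gt0 //; apply: f'0; exact: lt_trans sx.
Qed.

(** If $f(t) \ge e$, monotonicity gives $f \ge e$ on $(0, t]$, so $f(t) \le f(0) - k e^2 t$ by the
    mean value theorem. This is negative once $t > f(0)/(k e^2)$. No division by $f$, which may
    vanish, is involved. *)
Lemma riccati_decay (k : R) : 0 < k -> (forall t, 0 < t -> 0 <= f t) ->
  (forall t, 0 < t -> f' t <= - (k * f t ^+ 2)) -> f t @[t --> +oo] --> (0 : R).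
Proof.
move=> k0 f0 Hf'; apply/cvgrPdist_lt => e e0.
have f'0 t : 0 < t -> f' t <= 0.
  move=> t0; apply: le_trans (Hf' t t0) _.
  by rewrite oppr_le0 mulr_ge0 ?sqr_ge0 // ltW.
have ke : 0 < k * e ^+ 2 by rewrite mulr_gt0 // exprn_gt0.
near=> t.
have H1 : f 0 / (k * e ^+ 2) < t.
  by near: t; apply: nbhs_pinfty_gt; exact: num_real.
rewrite ltr_pdivrMr // mulrC in H1.
have t0 : 0 < t.
  by near: t; apply: nbhs_pinfty_gt; exact: num_real.
rewrite sub0r normrN ger0_norm ?f0 // ltNge; apply/negP => et.
have [s /andP[s0 st] E] := nonneg_MVT t0.
have es : e <= f s by apply: le_trans et _; apply: nonneg_nonincreasing;
  rewrite ?ltW.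
have : f' s * t <= - (k * e ^+ 2) * t.
  rewrite ler_pM2r //; apply: le_trans (Hf' s s0) _.
  rewrite lerN2 ler_pM2l // ler_sqr ?nnegrE //; first exact: ltW.
  by apply: le_trans es; apply: ltW.
rewrite -E => H2.
have := f0 t t0; rewrite leNgt => /negP; apply.
move: H1 H2; rewrite mulNr; set x := _ * t; lra.
Unshelve. all: by end_near. Qed.

End Monotone.
End NonnegCurves.

(** * Algebraic identities for the norm of the bracket *)

Section BracketNorm.
Variables (R : realType) (n : nat) (c : 'I_n -> 'I_n -> 'I_n -> R).
Hypothesis c_skew : forall a b d, c a b d = - c b a d.

Definition coef_norm2 : R := \sum_a \sum_b \sum_d c a b d ^+ 2.

Variable r : 'I_n -> 'I_n -> R.
Hypothesis rE : forall d e, r d e =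
    - 2^-1 * (\sum_a \sum_b c d a b * c e a b)
    + 4^-1 * (\sum_a \sum_b c a b d * c a b e).

Lemma ricci_coef_sym d e : r d e = r e d.
Proof.
rewrite !rE; congr (_ * _ + _ * _); apply: eq_bigr => a _;
  apply: eq_bigr => b _;
  exact: mulrC.
Qed.

(* The factor of 2 * c a b d is the derivative of c a b d along the flow when *)
(* r is the matrix of the Ricci operator.                                     *)
Lemma coef_norm2_derivative :
  \sum_a \sum_b \sum_d (2 * c a b d * (\sum_e r e a * c e b d
     + \sum_e r e b * c a e d - \sum_e r d e * c a b e)) =
  - (8 * \sum_a \sum_b r a b ^+ 2).
Proof.
(* [X] and [Y] contract [r] with the two quadratic expressions of [rE], so $\sum r^2 = -X/2 + Y/4$,
   while the left-hand side is $2(2X - Y)$. *)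
pose X := \sum_d \sum_e r d e * (\sum_a \sum_b c d a b * c e a b).
pose Y := \sum_d \sum_e r d e * (\sum_a \sum_b c a b d * c a b e).
have T1 : \sum_a \sum_b \sum_d c a b d * (\sum_e r e a * c e b d) = X.
  rewrite /X [RHS]exchange_big /=; apply: eq_bigr => a _.
  under [RHS]eq_bigr do rewrite mulr_sumr.
  rewrite [RHS]exchange_big; apply: eq_bigr => b _.
  under [RHS]eq_bigr do rewrite mulr_sumr.
  rewrite [RHS]exchange_big; apply: eq_bigr => d _ /=.
  by rewrite mulr_sumr; apply: eq_bigr => e _; ring.
have T2 : \sum_a \sum_b \sum_d c a b d * (\sum_e r e b * c a e d) = X.
  rewrite exchange_big -T1; apply: eq_bigr => a _; apply: eq_bigr => b _.
  apply: eq_bigr => d _; rewrite c_skew mulNr -mulrN; congr (_ * _).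
  rewrite -sumrN; apply: eq_bigr => e _; rewrite [c e b d]c_skew; ring.
have T3 : \sum_a \sum_b \sum_d c a b d * (\sum_e r d e * c a b e) = Y.
  have E a b d : c a b d * (\sum_e r d e * c a b e) =
    \sum_e r d e * (c a b d * c a b e).
    by rewrite mulr_sumr; apply: eq_bigr => e _; ring.
  under eq_bigr do under eq_bigr do under eq_bigr do rewrite E.
  under eq_bigr do rewrite exchange_big /=.
  rewrite exchange_big /Y; apply: eq_bigr => d _.
  under [RHS]eq_bigr do rewrite mulr_sumr.
  rewrite [RHS]exchange_big; apply: eq_bigr => a _.
  under [RHS]eq_bigr do rewrite mulr_sumr.
  by rewrite [RHS]exchange_big.
transitivity (2 * (X + X - Y)).
  rewrite -{1}T1 -T2 -T3 -big_split -sumrB mulr_sumr; apply: eq_bigr => a _ /=.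
  rewrite -big_split -sumrB mulr_sumr; apply: eq_bigr => b _ /=.
  rewrite -big_split -sumrB mulr_sumr; apply: eq_bigr => d _ /=.
  rewrite -mulrDr -mulrBr; ring.
rewrite mulrBr mulrDr !mulr_sumr -big_split -sumrB -sumrN;
  apply: eq_bigr => d _ /=.
rewrite !mulr_sumr -big_split -sumrB -sumrN; apply: eq_bigr => e _ /=.
rewrite expr2 [X in _ = - (_ * (_ * X))]rE; by field.
Qed.

(** The trace of [r] is $(-\frac12 + \frac14)$ times the squared norm. Cauchy-Schwarz bounds its
    square by $n$ times the sum of the squared diagonal entries; the constant $16$ is $4^2$. *)
Lemma coef_norm2_le : coef_norm2 ^+ 2 <= 16 * n%:R * \sum_a \sum_b r a b ^+ 2.
Proof.
have trE : \sum_a r a a = - 4^-1 * coef_norm2.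
  have X : \sum_d \sum_a \sum_b c d a b * c d a b = coef_norm2 by [].
  have Y : \sum_d \sum_a \sum_b c a b d * c a b d = coef_norm2.
    rewrite exchange_big; apply: eq_bigr => a _; rewrite exchange_big.
    by apply: eq_bigr => b _; apply: eq_bigr => d _; rewrite expr2.
  under eq_bigr do rewrite rE.
  rewrite big_split /= -!mulr_sumr X Y; by field.
have CS (x : 'I_n -> R) : (\sum_a x a) ^+ 2 <= n%:R * \sum_a x a ^+ 2.
  have : 0 <= \sum_a \sum_b (x a - x b) ^+ 2.
    by apply: sumr_ge0 => a _; apply: sumr_ge0 => b _; exact: sqr_ge0.
  have -> : \sum_a \sum_b (x a - x b) ^+ 2 =
      2 * (n%:R * \sum_a x a ^+ 2) - 2 * (\sum_a x a) ^+ 2.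
    have E a b : (x a - x b) ^+ 2 =
      x a ^+ 2 + x b ^+ 2 - 2 * (x a * x b) by ring.
    have E2 a : \sum_b (x a - x b) ^+ 2 =
        n%:R * x a ^+ 2 + \sum_b x b ^+ 2 - 2 * (\sum_b x b) * x a.
      under eq_bigr do rewrite E.
      rewrite sumrB big_split /= sumr_const card_ord -!mulr_sumr -mulr_natl.
      by ring.
    under eq_bigr do rewrite E2.
    rewrite sumrB big_split /= sumr_const card_ord -!mulr_sumr -mulr_natl.
    ring.
  by rewrite subr_ge0 ler_pM2l.
have diag : \sum_a r a a ^+ 2 <= \sum_a \sum_b r a b ^+ 2.
  apply: ler_sum => a _; rewrite (bigD1 a) //= lerDl.
  by apply: sumr_ge0 => b _; exact: sqr_ge0.
have := CS (fun a => r a a); rewrite trE => H.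
have : n%:R * \sum_a r a a ^+ 2 <= n%:R * \sum_a \sum_b r a b ^+ 2
  by rewrite ler_wpM2l.
move=> /(le_trans H); rewrite exprMn -mulrA => H2.
have := ler_wpM2l (ler0n R 16) H2; apply: le_trans.
by rewrite mulrA; set y := _ ^+ 2; have -> : 16 * (- 4^-1) ^+ 2 * y =
  y by rewrite /y; field.
Qed.

Lemma coef_le_norm2 a b d : c a b d ^+ 2 <= coef_norm2.
Proof.
rewrite /coef_norm2 (bigD1 a) //= (bigD1 b) //= (bigD1 d) //= -!addrA lerDl.
by rewrite !addr_ge0 //; do !(apply: sumr_ge0 => ? _); exact: sqr_ge0.
Qed.

End BracketNorm.

Lemma invmx_gram (R : realType) n (L : 'M[R]_n) :
  L \in unitmx -> invmx (L^T *m L) = invmx L *m (invmx L)^T.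
Proof.
move=> Lu; have LLu : L^T *m L \in unitmx by rewrite unitmx_mul unitmx_tr Lu.
apply: (can_inj (mulKmx LLu)).
by rewrite mulmxV // mulmxA mulmxK // -trmx_mul mulVmx // trmx1.
Qed.

(** * Left-invariant metrics from their value at the origin *)

Section InvariantMetrics.
Variables (R : realType) (n : nat).
Variable mu : 'cV[R]_n -> 'cV[R]_n -> 'cV[R]_n.
Hypothesis mu_nil : nilpotent_lie_bracket mu.

Let mu_linl := bracket_linear_left mu_nil.
Let mu_linr := bracket_linear_right mu_nil.
Let mu_skew := bracket_skew mu_nil.
Let ad_nil x := ad_mx_pow_dim mu_linl mu_linr (bracket_nilpotent mu_nil) x.

Lemma derive_bch x v : 'D_v (bch mu (- x)) x = translation_mx mu x *m v.
Proof.
have [_ ->] := is_derive_bch mu_linl mu_linr mu_skew x v.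
rewrite /translation_mx mulmx_suml; apply: eq_bigr => d _.
by rewrite -scalemxAl mul_ad_mx_pow.
Qed.

Lemma pullback_bch (g : tensor R n) x : pullback (bch mu (- x)) g x =
  (translation_mx mu x)^T *m g 0 *m translation_mx mu x.
Proof.
apply/matrixP => i j; rewrite mxE !derive_bch bch_self //.
by rewrite trmx_mul trmx_delta -!mulmxA -rowE mxE !mulmxA -colE !mxE.
Qed.

Lemma left_invariantE (g : tensor R n) : left_invariant mu g ->
  g = fun x => (translation_mx mu x)^T *m g 0 *m translation_mx mu x.
Proof. by move=> gi; apply/funext => x; rewrite -pullback_bch gi. Qed.

Lemma translation_mx0 : translation_mx mu 0 = 1%:M.
Proof.
apply/matrixP => i j.
by have [_ -> _ _] := mxjet2_translation mu_linl ad_nil i j.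
Qed.

Lemma invariant_metric0 G : invariant_metric mu G 0 = G.
Proof.
by rewrite /invariant_metric pullback_bch translation_mx0 trmx1 mul1mx mulmx1.
Qed.

Lemma left_invariant_ricci_frame (g : tensor R n) (L : 'M[R]_n) :
  riemannian_metric g -> left_invariant mu g -> L \in unitmx -> g 0 =
    L^T *m L ->
  forall d e, ((invmx L)^T *m ricci_tensor g 0 *m invmx L) d e =
    - 2^-1 * (\sum_a \sum_b frame_coef mu L d a b * frame_coef mu L e a b)
    + 4^-1 * (\sum_a \sum_b frame_coef mu L a b d * frame_coef mu L a b e).
Proof.
move=> [_ gpos] /left_invariantE gE Lu g0.
apply: ricci_frame => //.
- exact: tr_ad_mx mu_linl mu_linr (bracket_nilpotent mu_nil).
- exact: tr_ad_mx_mul mu_linl mu_linr (bracket_nilpotent mu_nil).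
- by move=> x; apply: inner_product_unitmx.
rewrite gE g0; exact: mxjet2_metric mu_linl ad_nil (L^T *m L).
Qed.

(** Symmetry is visible in the frame formula and is carried back by congruence, without curvature
    identities. *)
Lemma left_invariant_ricci_sym (g : tensor R n) :
  riemannian_metric g -> left_invariant mu g -> (ricci_tensor g 0)^T =
    ricci_tensor g 0.
Proof.
move=> gR gI; have [_ /(_ 0) g0] := gR; have [L LE] := cholesky g0.
have Lu : L \in unitmx.
  by have := inner_product_unitmx g0; rewrite -LE unitmx_mul => /andP[].
set Q := invmx L; have LQ : Q *m L = 1%:M by rewrite mulVmx.
have S : (Q^T *m ricci_tensor g 0 *m Q)^T = Q^T *m ricci_tensor g 0 *m Q.
  apply/matrixP => d e; rewrite mxE.
  by apply: ricci_coef_sym; exact: left_invariant_ricci_frame.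
have := congr1 (fun M => L^T *m M *m L) S.
rewrite !trmx_mul trmxK !mulmxA -trmx_mul LQ trmx1 !mul1mx.
by rewrite -!mulmxA LQ !mulmx1.
Qed.

End InvariantMetrics.

(** * Evolution of the metric and of the bracket along the flow *)

Section RicciFlow.
Variables (R : realType) (n : nat).
Variable mu : 'cV[R]_n -> 'cV[R]_n -> 'cV[R]_n.
Variables (G : 'M[R]_n) (g : R -> tensor R n) (h : R -> 'M[R]_n).
Hypothesis mu_nil : nilpotent_lie_bracket mu.
Hypothesis G_inner : inner_product G.
Hypothesis g_flow : invariant_ricci_flow mu (invariant_metric mu G) g.
Hypothesis h_unit : forall t : R, 0 <= t -> h t \in unitmx.
Hypothesis h_ode : forall t : R, 0 <= t ->
  is_derivative_on_nonneg h t (- (h t *m ricci_operator (g t) 0)).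
Hypothesis h0 : h 0 = 1%:M.

Let mu_linl := bracket_linear_left mu_nil.
Let mu_linr := bracket_linear_right mu_nil.
Let mu_skew := bracket_skew mu_nil.

Let rc t := ricci_tensor (g t) 0.

Let g00 : g 0 0 = G.
Proof. by rewrite (flow_init g_flow) invariant_metric0. Qed.

Let rcT (t : R) : 0 <= t -> (rc t)^T = rc t.
Proof.
move=> t0; apply: (left_invariant_ricci_sym mu_nil).
  exact: (flow_metric g_flow).
exact: (flow_invariant g_flow).
Qed.

Let gt_unit (t : R) : 0 <= t -> g t 0 \in unitmx.
Proof. by move=> t0; have [_ gp] := flow_metric g_flow t0;
  apply: inner_product_unitmx. Qed.
Let gtT (t : R) : 0 <= t -> (g t 0)^T = g t 0.
Proof. by move=> t0; have [_ /(_ 0)[]] := flow_metric g_flow t0. Qed.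

Let dh (t : R) : 0 < t -> is_derive t 1 h (- (h t *m (invmx (g t 0) *m rc t))).
Proof. by move=> t0; apply: is_derivative_on_nonneg_is_derive => //;
  apply: h_ode; exact: ltW. Qed.
Let dg (t : R) : 0 < t -> is_derive t 1 (fun s => g s 0) (- 2 *: rc t).
Proof.
move=> t0; apply: is_derivative_on_nonneg_is_derive => //.
by apply: (flow_eq g_flow); exact: ltW.
Qed.

Let dhV (t : R) : 0 < t ->
  is_derive t 1 (fun s => invmx (h s)) (invmx (g t 0) *m rc t *m invmx (h t)).
Proof.
move=> t0.
have hu : h t \in unitmx by apply: h_unit; exact: ltW.
have -> : invmx (g t 0) *m rc t *m invmx (h t) =
    - (invmx (h t) *m - (h t *m (invmx (g t 0) *m rc t)) *m invmx (h t)).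
  by rewrite mulmxN mulNmx opprK !mulmxA mulVmx // mul1mx.
apply: is_derive_invmx (dh t0).
have : \forall s \near t, 0 < s by exact: lt_nbhsr.
by apply: filterS => s s0; apply: h_unit; exact: ltW.
Qed.

Let h_right : h s @[s --> 0^'+] --> h 0.
Proof. by have := h_ode (lexx 0) => /is_derivative_on_nonneg_right. Qed.

Let g_right : g s 0 @[s --> 0^'+] --> g 0 0.
Proof. by have := flow_eq g_flow (x := 0) (lexx 0) =>
  /is_derivative_on_nonneg_right. Qed.
Let right_cont (f : R -> R) := f s @[s --> 0^'+] --> f 0.

Let right_cst c : right_cont (fun=> c). Proof. exact: cvg_cst. Qed.
Let right_add f f' : right_cont f -> right_cont f' ->
  right_cont (fun s => f s + f' s).
Proof. exact: cvgD. Qed.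
Let right_mul f f' : right_cont f -> right_cont f' ->
  right_cont (fun s => f s * f' s).
Proof. exact: cvgM. Qed.

Let right_entry m p (M : R -> 'M[R]_(m, p)) i j :
  M s @[s --> 0^'+] --> M 0 -> right_cont (fun s => M s i j).
Proof.
by move=> HM; exact: (cvg_comp _ _ HM (@coord_continuous R m p i j (M 0))).
Qed.

Let right_ext (f f' : R -> R) : (forall s : R, 0 <= s -> f s = f' s) ->
  right_cont f -> right_cont f'.
Proof.
move=> E; rewrite /right_cont E //; apply: cvg_trans; apply: near_eq_cvg.
have : \forall s \near 0^'+, (0 : R) < s by exact: nbhs_right_gt.
by apply: filterS => s s0; rewrite /= E // ltW.
Qed.

Let hV_right i j : right_cont (fun s => invmx (h s) i j).
Proof.
have hu : h 0 \in unitmx by apply: h_unit.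
have H : right_cont (fun s => (\det (h s))^-1 * (\adj (h s)) i j).
  apply: right_mul.
    apply: cvgV; first by rewrite -unitfE -unitmxE.
    by apply: (@ring_closed_det _ _ right_cont) => // k l; exact: right_entry.
  by apply: (@ring_closed_adj _ _ right_cont) => // k l; exact: right_entry.
apply: right_ext H => s s0; rewrite invmx_entry //; exact: h_unit.
Qed.

Let right_mulmx m p q (M : R -> 'M[R]_(m, p)) (N : R -> 'M[R]_(p, q)) :
  (forall i j, right_cont (fun s => M s i j)) ->
  (forall i j, right_cont (fun s => N s i j)) ->
  forall i j, right_cont (fun s => (M s *m N s) i j).
Proof. exact: (ring_closed_mulmx right_cst right_add right_mul). Qed.

(** The form $h^{-T} g(t)(0)\, h^{-1}$ is constant: each factor $h^{-1}$ contributes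
    $h^{-T}\operatorname{Rc} h^{-1}$ to its derivative, by symmetry of $\operatorname{Rc}$, and $g'$
    contributes minus twice that. Right continuity extends the conclusion to $t = 0$. *)
Lemma flow_metric_at0 (t : R) : 0 <= t -> g t 0 = (h t)^T *m G *m h t.
Proof.
move=> t0; have hu := h_unit t0.
suff E : (invmx (h t))^T *m g t 0 *m invmx (h t) = G.
  rewrite -E !mulmxA -trmx_mul mulVmx // trmx1 mul1mx.
  by rewrite -mulmxA mulVmx // mulmx1.
apply/matrixP => i j.
pose F s := ((invmx (h s))^T *m g s 0 *m invmx (h s)) i j.
suff : F t = F 0.
  by rewrite /F h0 invmx1 trmx1 mul1mx mulmx1 g00.
apply: (@nonneg_derive0_cst R F (fun=> 0)) => //.
  apply: right_mulmx => k l; last exact: hV_right.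
  apply: right_mulmx => k' l'; last exact: right_entry.
  have -> : (fun s => (invmx (h s))^T k' l') = fun s => invmx (h s) l' k'.
    by apply/funext => s; rewrite mxE.
  exact: hV_right.
move=> s s0; have /= := is_derive_mulmx
  (is_derive_mulmx (is_derive_trmx (dhV s0)) (dg s0)) (dhV s0).
set D := (X in is_derive _ _ _ X).
suff -> : D = const_mx 0 by move=> /is_derive_mxP/(_ i j); rewrite mxE.
rewrite /D; set W := invmx (g s 0); set Hi := invmx (h s).
have s0' := ltW s0.
have WT : W^T = W by rewrite trmx_inv gtT.
have -> : (W *m rc s *m Hi)^T *m g s 0 = Hi^T *m rc s.
  rewrite !trmx_mul WT rcT // -!mulmxA mulVmx ?mulmx1 //; exact: gt_unit.
have -> : Hi^T *m g s 0 *m (W *m rc s *m Hi) = Hi^T *m rc s *m Hi.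
  rewrite !mulmxA -[_ *m g s 0 *m W]mulmxA mulmxV ?mulmx1 //; exact: gt_unit.
rewrite -scalemxAr scaleNr scaler_nat mulmxDl mulNmx mulr2n mulmxDl opprD.
have -> : const_mx 0 = 0 :> 'M[R]_n by [].
set Z := Hi^T *m rc s *m Hi.
by rewrite addrA subrr sub0r addNr.
Qed.

Variable P : 'M[R]_n.
Hypothesis PG : P^T *m P = G.

(** The columns of [Q t] form a basis orthonormal for $g(t)(0)$ at every time, as in Uhlenbeck's
    trick; [r t] below is the Ricci tensor in it. *)
Let L t := P *m h t.
Let Q t := invmx (L t).

Let P_unit : P \in unitmx.
Proof.
by have := inner_product_unitmx G_inner; rewrite -PG unitmx_mul => /andP[].
Qed.

Let L_unit (t : R) : 0 <= t -> L t \in unitmx.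
Proof. by move=> t0; rewrite unitmx_mul P_unit h_unit. Qed.

Let flow_gram (t : R) : 0 <= t -> g t 0 = (L t)^T *m L t.
Proof. by move=> t0; rewrite flow_metric_at0 // -PG trmx_mul !mulmxA. Qed.

Let LQ (t : R) : 0 <= t -> L t *m Q t = 1%:M.
Proof. by move=> t0; rewrite mulmxV ?L_unit. Qed.

Let r t := (Q t)^T *m rc t *m Q t.

Let dL (t : R) : 0 < t -> is_derive t 1 L (- (r t *m L t)).
Proof.
move=> t0; have t0' := ltW t0.
have -> : - (r t *m L t) = 0 *m h t + P *m - (h t *m (invmx (g t 0) *m rc t)).
  rewrite mul0mx add0r mulmxN flow_gram // invmx_gram ?L_unit //; congr (- _).
  rewrite (mulmxA P) -/(L t) /r -(mulmxA _ (Q t)) mulVmx ?L_unit // mulmx1.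
  by rewrite !mulmxA mulmxV ?L_unit // mul1mx.
by apply: is_derive_mulmx (dh t0); exact: is_derive_cst.
Qed.

Let dQ (t : R) : 0 < t -> is_derive t 1 Q (Q t *m r t).
Proof.
move=> t0; have t0' := ltW t0.
have -> : Q t *m r t = - (Q t *m - (r t *m L t) *m Q t).
  by rewrite mulmxN mulNmx opprK -(mulmxA (Q t)) -(mulmxA (r t)) LQ // mulmx1.
apply: is_derive_invmx (dL t0).
have : \forall s \near t, 0 < s by exact: lt_nbhsr.
by apply: filterS => s s0; apply: L_unit; exact: ltW.
Qed.

Let c t := frame_coef mu (L t).

Let colQE t (M : 'M[R]_n) a : col a (Q t *m M) = \sum_e M e a *: col e (Q t).
Proof.
apply/matrixP => i j; rewrite mxE summxE mxE; apply: eq_bigr => e _.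
by rewrite !mxE mulrC.
Qed.

(** The bracket flow: $Q' = Q r$ acts on the two arguments and $L' = -r L$ on the value, which
    produces the factor in [coef_norm2_derivative]. *)
Let dc (t : R) a b d : 0 < t -> is_derive t 1 (fun s => c s a b d)
  (\sum_e r t e a * c t e b d + \sum_e r t e b * c t a e d
   - \sum_e r t d e * c t a b e).
Proof.
move=> t0.
have dcol k : is_derive t 1 (fun s => col k (Q s)) (col k (Q t *m r t)).
  apply/is_derive_mxP => i j; rewrite mxE; under eq_fun do rewrite mxE.
  exact: ((is_derive_mxP _ _ _ _).1 (dQ t0)).
have dmu := is_derive_bracket mu_linl mu_linr (dcol a) (dcol b).
have := (is_derive_mxP _ _ _ _).1 (is_derive_mulmx (dL t0) dmu) d 0.
rewrite /c /frame_coef -/(Q t).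
set D := (X in is_derive _ _ _ X); set D' := (X in _ -> is_derive _ _ _ X).
suff -> : D = D' by [].
rewrite /D /D' !colQE bracket_suml // bracket_sumr // mulNmx mulmxDr.
rewrite !mulmx_sumr mxE addrC; congr (_ + _).
  rewrite mxE !summxE; congr (_ + _); apply: eq_bigr => e _.
    by rewrite bracketZl // -scalemxAr mxE.
  by rewrite bracketZr // -scalemxAr mxE.
by rewrite mxE -mulmxA mxE.
Qed.

Let c_right a b d : right_cont (fun s => c s a b d).
Proof.
have Q_right i j : right_cont (fun s => Q s i j).
  have : right_cont (fun s => (invmx (h s) *m invmx P) i j).
    by apply: right_mulmx => // k l; exact: right_cst.
  apply: right_ext => s s0; congr (fun_of_matrix _ _ _).
  have Ls := L_unit s0; apply: (can_inj (mulKmx Ls)).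
  by rewrite mulmxV // /L mulmxA mulmxK ?h_unit // mulmxV.
apply: right_mulmx => i j.
  by apply: right_mulmx => k l; [exact: right_cst | exact: right_entry].
have E s : mu (col a (Q s)) (col b (Q s)) i j =
    \sum_k \sum_l (Q s k a * Q s l b) * mu (delta_mx k 0) (delta_mx l 0) i j.
  rewrite [col a _]cV_sum_delta [col b _]cV_sum_delta bracket_suml // summxE.
  apply: eq_bigr => k _; rewrite bracketZl // bracket_sumr // scaler_sumr
    summxE.
  by apply: eq_bigr => l _; rewrite bracketZr // scalerA !mxE.
apply: (right_ext (f := fun s =>
  \sum_k \sum_l (Q s k a * Q s l b) * mu (delta_mx k 0) (delta_mx l 0) i j)).
  by move=> s _; rewrite E.
do 2!(apply: (ring_closed_sum right_cst right_add) => ? _).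
by do 2!apply: right_mul => //.
Qed.
Lemma frame_coef_cvg0 a b d : frame_coef mu (L t) a b d @[t --> +oo] -->
  (0 : R).
Proof.
pose N t := coef_norm2 (c t).
have rE (t : R) (t0 : 0 <= t) := left_invariant_ricci_frame mu_nil
  (flow_metric g_flow t0) (flow_invariant g_flow t0) (L_unit t0) (flow_gram t0).
(* The index [a] witnesses that the dimension is positive. *)
have n0 : (0 : R) < n%:R by rewrite ltr0n; case: (n) a => // -[].
have dN (t : R) : 0 < t -> is_derive t 1 N (- (8 * \sum_a \sum_b r t a b ^+ 2)).
  move=> t0; rewrite -(@coef_norm2_derivative R n (c t)) => //; first last.
  - exact: rE (ltW t0).
  - exact: frame_coef_skew.
  apply: is_derive_sum_fun => i _; apply: is_derive_sum_fun => j _.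
  apply: is_derive_sum_fun => k _.
  have Hc := dc i j k t0; have := is_deriveM_fun Hc Hc.
  set D := (X in is_derive _ _ _ X); set D' := (X in _ -> is_derive _ _ _ X).
  suff -> : D = D' by [].
  rewrite /D /D'; set u := _ - _; ring.
have N_right : N s @[s --> 0^'+] --> N 0.
  do 3!(apply: (ring_closed_sum right_cst right_add) => ? _).
  by apply: right_mul.
have N_cvg : N t @[t --> +oo] --> (0 : R).
  (* The rate is $8/(16 n)$, from the factor $8$ in [dN] and the constant of [coef_norm2_le]. *)
  apply: (riccati_decay N_right dN (k := (2 * n%:R)^-1)).
  - by rewrite invr_gt0 mulr_gt0.
  - by move=> t _; do 3!(apply: sumr_ge0 => ? _); exact: sqr_ge0.
  move=> t t0; rewrite lerN2.
  rewrite ler_pdivrMl ?mulr_gt0 // mulrA.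
  have -> : 2 * n%:R * 8 = 16 * n%:R :> R by ring.
  by apply: coef_norm2_le; exact: rE (ltW t0).
apply/cvgrPdist_lt => e e0.
have /cvgrPdist_lt/(_ _ (exprn_gt0 2 e0)) := N_cvg.
apply: filterS => t; rewrite !sub0r !normrN => H.
rewrite -(ltr_pXn2r (n := 2)) ?nnegrE ?normr_ge0 ?ltW //.
rewrite real_normK ?num_real //;
  apply: le_lt_trans (coef_le_norm2 (c t) a b d) _.
by apply: le_lt_trans H; exact: ler_norm.
Qed.

End RicciFlow.

(** * Uniform convergence of polynomial families *)

Section PolynomialFamilies.
Variables (R : realType) (n : nat).
Implicit Types F : option R -> 'cV[R]_n -> R.

(* A family of functions indexed by time; its value at None is the limit of   *)
(* the others at +oo.                                                         *)
Inductive cvg_poly_family : (option R -> 'cV[R]_n -> R) -> Prop :=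
| cvg_poly_family_cst (c : option R -> R) :
    c (Some t) @[t --> +oo] --> c None -> cvg_poly_family (fun o _ => c o)
| cvg_poly_family_coord k : cvg_poly_family (fun _ x => x k 0)
| cvg_poly_familyD F1 F2 : cvg_poly_family F1 -> cvg_poly_family F2 ->
    cvg_poly_family (fun o x => F1 o x + F2 o x)
| cvg_poly_familyM F1 F2 : cvg_poly_family F1 -> cvg_poly_family F2 ->
    cvg_poly_family (fun o x => F1 o x * F2 o x).

Lemma cvg_poly_family_polyfun F o : cvg_poly_family F -> polyfun (F o).
Proof.
elim=> [c _|k|F1 F2 _ p1 _ p2|F1 F2 _ p1 _ p2].
- exact: polyfun_cst.
- exact: polyfun_coord.
- exact: polyfunD.
- exact: polyfunM.
Qed.

Lemma cvg_poly_family_partial i F :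
  cvg_poly_family F -> cvg_poly_family (fun o => partial i (F o)).
Proof.
elim=> [c _|k|F1 F2 f1 p1 f2 p2|F1 F2 f1 p1 f2 p2].
- under eq_fun do rewrite partial_cst.
  by apply: (@cvg_poly_family_cst (fun=> 0)); exact: cvg_cst.
- under eq_fun do rewrite partial_coord.
  by apply: (@cvg_poly_family_cst (fun=> (k == i)%:R)); exact: cvg_cst.
- have -> : (fun o => partial i (fun x => F1 o x + F2 o x)) =
      fun o x => partial i (F1 o) x + partial i (F2 o) x.
    apply/funext => o; rewrite partialD //; exact: cvg_poly_family_polyfun.
  exact: cvg_poly_familyD.
have -> : (fun o => partial i (fun x => F1 o x * F2 o x)) =
    fun o x => partial i (F1 o) x * F2 o x + F1 o x * partial i (F2 o) x.
  apply/funext => o; rewrite partialM //; exact: cvg_poly_family_polyfun.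
by apply: cvg_poly_familyD; apply: cvg_poly_familyM.
Qed.

Lemma cvg_poly_family_partials alpha F :
  cvg_poly_family F -> cvg_poly_family (fun o => partials alpha (F o)).
Proof.
by move=> HF; elim: alpha => [//|i alpha IH]; apply: cvg_poly_family_partial IH.
Qed.

Lemma polyfun_bounded (K : set 'cV[R]_n) f : compact K -> polyfun f ->
  exists2 M : R, 0 < M & forall x, K x -> `|f x| <= M.
Proof.
move=> Kc pf.
have : compact (f @` K).
  apply: continuous_compact => //; apply: continuous_subspaceT => x.
  exact: differentiable_continuous (polyfun_differentiable x pf).
move=> /compact_bounded [M [_ HM]]; exists (Num.max M 0 + 1).
  by rewrite ltr_pwDr // le_max lexx orbT.
move=> x Kx; apply: (HM (Num.max M 0 + 1)); last by exists x.
by rewrite ltr_pwDr // le_max lexx.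
Qed.
Lemma cvg_poly_family_uniform (K : set 'cV[R]_n) F : compact K ->
  cvg_poly_family F ->
  forall e : R, 0 < e ->
    \forall t \near +oo, forall x, K x -> `|F None x - F (Some t) x| < e.
Proof.
move=> Kc; elim=> [c Hc|k|F1 F2 f1 p1 f2 p2|F1 F2 f1 p1 f2 p2] e e0.
- have /cvgrPdist_lt/(_ _ e0) := Hc; exact: filterS.
- by apply: nearW => t x _; rewrite subrr normr0.
- have e20 : 0 < e / 2 by rewrite divr_gt0.
  near=> t => x Kx.
  have H1 : forall x, K x -> `|F1 None x - F1 (Some t) x| < e / 2 by near: t;
    exact: p1.
  have H2 : forall x, K x -> `|F2 None x - F2 (Some t) x| < e / 2 by near: t;
    exact: p2.
  rewrite opprD addrACA (splitr e).
  by apply: le_lt_trans (ler_normD _ _) _; rewrite ltrD ?H1 ?H2.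
have [M1 M10 HM1] := polyfun_bounded Kc (cvg_poly_family_polyfun None f1).
have [M2 M20 HM2] := polyfun_bounded Kc (cvg_poly_family_polyfun None f2).
(* Both factors are to vary by less than [d]. The product then varies by less than $d (M_1 + M_2) +
   d^2$, which is at most $d (M_1 + M_2 + 1) \le e$ because $d \le 1$. *)
pose d := Num.min 1 (e / (M1 + M2 + 1)).
have M0 : 0 < M1 + M2 + 1 by rewrite !addr_gt0.
have d0 : 0 < d by rewrite lt_min ltr01 divr_gt0.
have d1 : d <= 1 by rewrite ge_min lexx.
have dM : d * (M1 + M2 + 1) <= e by rewrite -ler_pdivlMr // ge_min lexx orbT.
near=> t => x Kx.
have H1 : forall x, K x -> `|F1 None x - F1 (Some t) x| < d by near: t;
  exact: p1.
have H2 : forall x, K x -> `|F2 None x - F2 (Some t) x| < d by near: t;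
  exact: p2.
move: (H1 x Kx) (H2 x Kx) (HM1 x Kx) (HM2 x Kx).
set a := F1 None x; set b := F2 None x; set u := a - _;
  set v := b - _ => ud vd aM bM.
have -> : a * b - F1 (Some t) x * F2 (Some t) x = a * v + u * b - u * v.
  by rewrite /u /v; ring.
apply: lt_le_trans dM.
apply: le_lt_trans (ler_normB _ _) _.
apply: le_lt_trans (lerD (ler_normD _ _) (lexx _)) _; rewrite !normrM.
have E1 : `|a| * `|v| <= M1 * `|v| by rewrite ler_wpM2r.
have E2 : `|u| * `|b| <= M2 * `|u| by rewrite mulrC ler_wpM2r.
have E3 : `|u| * `|v| <= d * 1 by rewrite ler_pM // ltW // (lt_le_trans vd).
have E4 : M1 * `|v| < M1 * d by rewrite ltr_pM2l.
have E5 : M2 * `|u| < M2 * d by rewrite ltr_pM2l.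
move: E1 E2 E3 E4 E5; set p := `|a| * _; set q := _ * `|b|;
  set w := `|u| * `|v|.
set m1 := M1 * _; set m2 := M2 * `|u|.
rewrite !mulrDr mulr1 [d * M1]mulrC [d * M2]mulrC; lra.
Unshelve. all: by end_near. Qed.

End PolynomialFamilies.

(** * Smooth convergence of metrics with converging brackets *)

Section MetricConvergence.
Variables (R : realType) (n : nat).

(** The class of families is stable under [partial], so one uniform estimate on compact sets covers
    all multi-indices. *)
Lemma cvg_smooth_compact_family (g : R -> tensor R n) (g' : tensor R n)
    (F : 'I_n -> 'I_n -> option R -> 'cV[R]_n -> R) :
  (forall i j, cvg_poly_family (F i j)) ->
  (forall i j t, 0 <= t -> (fun x => g t x i j) = F i j (Some t)) ->
  (forall i j, (fun x => g' x i j) = F i j None) ->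
  cvg_smooth_compact g g'.
Proof.
move=> HF Eg Eg' alpha i j; apply/fam_cvgP => K Kc U.
rewrite uniform_nbhs => -[E [entE EU]].
move: entE; rewrite -entourage_ballE => -[e /= e0 eE].
have := cvg_poly_family_uniform Kc (cvg_poly_family_partials alpha (HF i j)) e0.
have : \forall t \near +oo, (0 : R) <= t by exact: nbhs_pinfty_ge.
apply: filterS2 => t t0 H; apply: EU => x Kx; apply: eE.
by rewrite /= Eg // Eg' /ball /=; exact: H.
Qed.

Variable mu : option R -> 'cV[R]_n -> 'cV[R]_n -> 'cV[R]_n.
Hypothesis mu_linl : forall o y, linear (mu o ^~ y).
Hypothesis mu_cvg : forall i j k,
  mu (Some t) (delta_mx i 0) (delta_mx j 0) k 0 @[t --> +oo] -->
  mu None (delta_mx i 0) (delta_mx j 0) k 0.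

(** Uncurried form, in which families are real functions on one type and the ring closure lemmas
    apply. *)
Let fam (f : option R * 'cV[R]_n -> R) := cvg_poly_family (fun o x => f (o, x)).

Let fam_cst c : fam (fun=> c).
Proof. by apply: (@cvg_poly_family_cst _ _ (fun=> c)); exact: cvg_cst. Qed.
Let fam_add f f' : fam f -> fam f' -> fam (fun s => f s + f' s).
Proof. exact: cvg_poly_familyD. Qed.
Let fam_mul f f' : fam f -> fam f' -> fam (fun s => f s * f' s).
Proof. exact: cvg_poly_familyM. Qed.

Lemma cvg_poly_family_metric (G : 'M[R]_n) i j : cvg_poly_family (fun o x =>
  ((translation_mx (mu o) x)^T *m G *m translation_mx (mu o) x) i j).
Proof.
have mulP := ring_closed_mulmx fam_cst fam_add fam_mul.
have adP k l : fam (fun s => ad_mx (mu s.1) s.2 k l).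
  have -> : (fun s : option R * 'cV[R]_n => ad_mx (mu s.1) s.2 k l) =
      fun s => \sum_m s.2 m 0 * ad_mx (mu s.1) (delta_mx m 0) k l.
    by apply/funext => s; rewrite ad_mxE.
  apply: (ring_closed_sum fam_cst fam_add) => m _; apply: fam_mul.
    exact: cvg_poly_family_coord.
  apply: (@cvg_poly_family_cst _ _ (fun o => ad_mx (mu o) (delta_mx m 0) k l)).
  rewrite mxE; under eq_fun do rewrite mxE; exact: mu_cvg.
have powP d k l : fam (fun s => (ad_mx (mu s.1) s.2 ^+ d) k l).
  elim: d k l => [|d IHd] k l; first exact: fam_cst.
  have -> : (fun s : option R * 'cV[R]_n => (ad_mx (mu s.1) s.2 ^+ d.+1) k l) =
      fun s => (ad_mx (mu s.1) s.2 *m ad_mx (mu s.1) s.2 ^+ d) k l.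
    by apply/funext => s; rewrite exprS.
  exact: mulP.
have traP k l : fam (fun s => translation_mx (mu s.1) s.2 k l).
  have -> : (fun s : option R * 'cV[R]_n => translation_mx (mu s.1) s.2 k l) =
      fun s => \sum_(d < n) bch_coef R d.+1 * (ad_mx (mu s.1) s.2 ^+ d) k l.
    apply/funext => s; rewrite summxE; apply: eq_bigr => d _; exact: mxE.
  by apply: (ring_closed_sum fam_cst fam_add) => d _; apply: fam_mul.
apply: (mulP _ _ _ (fun s : option R * 'cV[R]_n =>
  (translation_mx (mu s.1) s.2)^T *m G)
  (fun s => translation_mx (mu s.1) s.2)) => // k l.
apply: mulP => // k' l'.
have -> : (fun s : option R * 'cV[R]_n =>
  (translation_mx (mu s.1) s.2)^T k' l') =
    fun s => translation_mx (mu s.1) s.2 l' k' by apply/funext => s;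
      rewrite mxE.
exact: traP.
Qed.

End MetricConvergence.

(** * Conjugating the bracket by a linear map *)

Section ConjugateBracket.
Variables (R : realType) (n : nat).
Variable mu : 'cV[R]_n -> 'cV[R]_n -> 'cV[R]_n.
Hypothesis mu_linl : forall y, linear (mu ^~ y).
Hypothesis mu_linr : forall x, linear (mu x).

(** For invertible [H] this is the bracket that makes [H] an isomorphism from [mu] onto it. *)
Definition conj_bracket (H : 'M[R]_n) (x y : 'cV[R]_n) : 'cV[R]_n :=
  H *m mu (invmx H *m x) (invmx H *m y).

Lemma conj_bracket_linl H y : linear (conj_bracket H ^~ y).
Proof.
move=> a u v.
by rewrite /conj_bracket /= mulmxDr -scalemxAr (bracketDl mu_linl)
  (bracketZl mu_linl) mulmxDr -scalemxAr.
Qed.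

Lemma conj_bracket_linr H x : linear (conj_bracket H x).
Proof.
move=> a u v.
by rewrite /conj_bracket /= mulmxDr -scalemxAr (bracketDr mu_linr)
  (bracketZr mu_linr) mulmxDr -scalemxAr.
Qed.

Lemma ad_mx_conj H x : H \in unitmx ->
  ad_mx (conj_bracket H) x = H *m ad_mx mu (invmx H *m x) *m invmx H.
Proof.
move=> Hu; apply/matrixP => i j.
have colE' (A : 'M[R]_n) : A i j =
  (A *m delta_mx j 0 : 'cV_n) i 0 by rewrite -colE [RHS]mxE.
rewrite !colE'; rewrite (mul_ad_mx (conj_bracket_linr H)).
by rewrite -!mulmxA mul_ad_mx.
Qed.

Lemma translation_mx_conj H x : H \in unitmx ->
  translation_mx (conj_bracket H) x =
  H *m translation_mx mu (invmx H *m x) *m invmx H.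
Proof.
move=> Hu; rewrite /translation_mx mulmx_sumr mulmx_suml; apply: eq_bigr => d _.
rewrite -scalemxAr -scalemxAl; congr (_ *: _).
elim: (nat_of_ord d) => [|m IHm].
  by rewrite !expr0 mulmx1 mulmxV.
rewrite !exprS IHm ad_mx_conj // -![_ * _]/(_ *m _) !mulmxA.
by rewrite mulmxKV.
Qed.

End ConjugateBracket.

Section ConjugateFlow.
Variables (R : realType) (n : nat).
Variable mu : 'cV[R]_n -> 'cV[R]_n -> 'cV[R]_n.
Hypothesis mu_nil : nilpotent_lie_bracket mu.

Let mu_linl := bracket_linear_left mu_nil.
Let mu_linr := bracket_linear_right mu_nil.

(** With [P] fixed, the coefficients of the frame constants do not depend on [H], so decay in the
    moving frame passes to the standard basis. *)
Lemma conj_bracket_frame (P H : 'M[R]_n) i j k : P \in unitmx -> H \in unitmx ->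
  conj_bracket mu H (delta_mx i 0) (delta_mx j 0) k 0 =
  \sum_a \sum_b \sum_d P a i * P b j * invmx P k d * frame_coef mu (P *m H) a b
    d.
Proof.
move=> Pu Hu; have Lu : P *m H \in unitmx by rewrite unitmx_mul Pu.
set Q := invmx (P *m H).
have PE l : invmx H *m delta_mx l 0 = \sum_a P a l *: col a Q.
  have -> : invmx H = Q *m P.
    apply: (can_inj (mulKmx Lu)); rewrite mulmxA mulmxV // mul1mx.
    by rewrite -mulmxA mulmxV // mulmx1.
  apply/matrixP => u v; rewrite -colE !mxE summxE; apply: eq_bigr => a _.
  by rewrite !mxE mulrC.
have -> : conj_bracket mu H (delta_mx i 0) (delta_mx j 0) =
    invmx P *m ((P *m H) *m mu (invmx H *m delta_mx i 0)
      (invmx H *m delta_mx j 0)).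
  by rewrite /conj_bracket !mulmxA mulVmx // mul1mx.
rewrite !PE (bracket_suml mu_linl) !mulmx_sumr summxE; apply: eq_bigr => a _.
rewrite (bracketZl mu_linl) (bracket_sumr mu_linr) scaler_sumr !mulmx_sumr
  summxE.
apply: eq_bigr => b _; rewrite (bracketZr mu_linr) scalerA mxE.
apply: eq_bigr => d _; rewrite -scalemxAr mxE mulrCA /frame_coef -/Q.
by rewrite mulrA.
Qed.

Lemma pullback_linear (H : 'M[R]_n) (g : tensor R n) x :
  pullback (fun y => H *m y) g x = H^T *m g (H *m x) *m H.
Proof.
have D i : 'D_(delta_mx i 0) (fun y : 'cV[R]_n => H *m y) x = H *m delta_mx i 0.
  have HD := is_derive_mulmx (is_derive_cst H x (delta_mx i 0 : 'cV_n))
    (is_derive_id x (delta_mx i 0 : 'cV_n)).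
  by have [_ ->] := HD; rewrite mul0mx add0r.
apply/matrixP => i j; rewrite mxE !D.
by rewrite trmx_mul trmx_delta -!mulmxA -rowE mxE !mulmxA -colE !mxE.
Qed.

End ConjugateFlow.

(** * Convergence to the flat metric *)

Lemma zero_bracket_nilpotent (R : realType) n :
  nilpotent_lie_bracket (fun _ _ : 'cV[R]_n => 0).
Proof.
split.
- by move=> y a u v; rewrite scaler0 addr0.
- by move=> y a u v; rewrite scaler0 addr0.
- by move=> x y; rewrite oppr0.
- by move=> x y z; rewrite !addr0.
exists 1%N; apply/eqP; rewrite -subv0 /=; apply/span_subvP => w.
by case/allpairsPdep => a [b [_ _ ->]]; rewrite mem0v.
Qed.

Theorem mainTheorem5 (R : realType) (n : nat)
    (mu0 : 'cV[R]_n -> 'cV[R]_n -> 'cV[R]_n) (G : 'M[R]_n)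
    (g : R -> tensor R n) (h : R -> 'M[R]_n)
    (hmu0 : nilpotent_lie_bracket mu0)
    (hG : inner_product G)
    (hg : invariant_ricci_flow mu0 (invariant_metric mu0 G) g)
    (hGL : forall t : R, 0 <= t -> h t \in unitmx)
    (hode : forall t : R, 0 <= t ->
       is_derivative_on_nonneg h t (- (h t *m ricci_operator (g t) 0)))
    (hinit : h 0 = 1%:M) :
  cvg_smooth_compact
    (fun t => pullback (fun x => invmx (h t) *m x) (g t))
    (invariant_metric (fun _ _ => 0) G).
Proof.
have [P PG] := cholesky hG.
have Pu : P \in unitmx.
  by have := inner_product_unitmx hG; rewrite -PG unitmx_mul => /andP[].
have linl := bracket_linear_left hmu0; have linr := bracket_linear_right hmu0.
(* The limit, at [None], is the abelian bracket, whose invariant metric is the flat one. *)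
pose mu (o : option R) := if o is Some t then conj_bracket mu0 (h t) else
  fun _ _ => 0.
have mu_linl o y : linear (mu o ^~ y).
  case: o => [t|] /=; first exact: conj_bracket_linl.
  by move=> a u v; rewrite scaler0 addr0.
have mu_cvg i j k : mu (Some t) (delta_mx i 0) (delta_mx j 0) k 0 @[t --> +oo]
  -->
    mu None (delta_mx i 0) (delta_mx j 0) k 0.
  have H : \sum_a \sum_b \sum_d P a i * P b j * invmx P k d *
      frame_coef mu0 (P *m h t) a b d @[t --> +oo] --> (0 : R).
    have sum0 (f : 'I_n -> R -> R) :
      (forall a, f a t @[t --> +oo] --> (0 : R)) ->
        \sum_a f a t @[t --> +oo] --> (0 : R).
      move=> Hf; elim: (index_enum _) => [|a s IHs].
        by under eq_fun do rewrite big_nil; exact: cvg_cst.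
      under eq_fun do rewrite big_cons.
      by have H := cvgD (Hf a) IHs; rewrite addr0 in H; exact: H.
    apply: (sum0) => a; apply: (sum0) => b; apply: (sum0) => d.
    have C := frame_coef_cvg0 hmu0 hG hg hGL hode hinit PG a b d.
    have H := cvgM (cvg_cst (P a i * P b j * invmx P k d)) C.
    by rewrite mulr0 in H; exact: H.
  rewrite /= mxE; apply: cvg_trans H; apply: near_eq_cvg.
  have : \forall t \near +oo, (0 : R) <= t by exact: nbhs_pinfty_ge.
  by apply: filterS => t t0;
    rewrite (conj_bracket_frame hmu0 _ _ _ Pu (hGL t t0)).
pose F i j o x := ((translation_mx (mu o) x)^T *m G *m translation_mx (mu o) x)
  i j.
apply: (@cvg_smooth_compact_family _ _ _ _ F).
- by move=> i j; apply: cvg_poly_family_metric.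
(* With $A$ the translation matrix of [mu0] at $h^{-1}x$, the pullback is $h^{-T} A^T (h^T G h) A
   h^{-1}$. Grouping the factors as $h A h^{-1}$ gives the metric of the conjugate bracket with
   value $G$ at $0$. *)
- move=> i j t t0; apply/funext => x; rewrite /F pullback_linear.
  have hu := hGL t t0.
  rewrite /= translation_mx_conj //
    (left_invariantE hmu0 (flow_invariant hg t0)).
  rewrite (flow_metric_at0 hmu0 hg hGL hode hinit t0).
  by rewrite !trmx_mul !mulmxA.
move=> i j; apply/funext => x.
by rewrite /invariant_metric (pullback_bch (zero_bracket_nilpotent R n)).
Qed.
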